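(* There are absolute constants $C>1$ and $c>0$ such that the following holds. Let $f=f_n:\{-1,1\}^n\to\{0,1\}$ be a family of Boolean functions indexed by $n$, let $\tau=\mathrm{MaxInf}(f)<1/C$, and suppose $\mathrm{Var}[f]=2^{-o(n)}$ as $n\to\infty$. Then for all sufficiently large $n$, \[ \Pr_x\left[\mathrm{bs}_f(x)\ge\frac{\mathrm{Var}[f]\ln(1/\tau)}{C\ln\ln(1/\tau)}\right]\ge 1-\exp\left(-c\,\frac{1}{\mathrm{Var}[f]}\ln\ln\frac1\tau\right), \] where $x$ is uniform on $\{-1,1\}^n$.
   Context: For $f:\{-1,1\}^n\to\{0,1\}$ with Fourier expansion $f=\sum_S\hat f(S)\prod_{j\in S}x_j$, $\mathrm{Inf}_i(f)=\sum_{S\ni i}\hat f(S)^2$ and $\mathrm{MaxInf}(f)=\max_i\mathrm{Inf}_i(f)$; $\mathrm{Var}[f]$ is the variance under the uniform distribution. The block sensitivity $\mathrm{bs}_f(x)$ is the maximum number $m$ of pairwise disjoint sets $S_1,\dots,S_m\subseteq[n]$ such that for each $i$, $f(x)\ne f(x^{(S_i)})$, where $x^{(S_i)}$ is $x$ with the signs of all coordinates in $S_i$ flipped. $\ln$ is the natural logarithm. *)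

(* Defs.v *)
From mathcomp Require Import all_boot all_order all_algebra.
From mathcomp Require Import all_classical all_reals all_analysis.

Set Implicit Arguments.
Unset Strict Implicit.
Unset Printing Implicit Defensive.

Import Order.TTheory GRing.Theory Num.Theory.
Import numFieldNormedType.Exports.

Local Open Scope classical_set_scope.
Local Open Scope ring_scope.

(* {-1,1}^n, with [false] standing for the sign 1 and [true] for -1; [coord]
   gives the actual +-1 value.  A function to {0,1} is a function to bool. *)
Definition cube (n : nat) := {ffun 'I_n -> bool}.

Definition coord (R : realType) (n : nat) (x : cube n) (j : 'I_n) : R :=
  (-1) ^+ (x j).

Definition flip (n : nat) (x : cube n) (S : {set 'I_n}) : cube n :=
  [ffun j => x j (+) (j \in S)].

Definition expect (R : realType) (n : nat) (g : cube n -> R) : R :=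
  (\sum_(x : cube n) g x) / #|{: cube n}|%:R.

Definition Pr (R : realType) (n : nat) (E : cube n -> bool) : R :=
  expect (fun x => (E x)%:R).

Definition Var (R : realType) (n : nat) (f : cube n -> bool) : R :=
  expect (fun x => ((f x)%:R - expect (fun y => (f y)%:R)) ^+ 2).

Definition chi (R : realType) (n : nat) (S : {set 'I_n}) (x : cube n) : R :=
  \prod_(j in S) coord R x j.

Definition fourier (R : realType) (n : nat) (f : cube n -> bool)
  (S : {set 'I_n}) : R := expect (fun x => (f x)%:R * chi R S x).

Definition Inf (R : realType) (n : nat) (f : cube n -> bool) (i : 'I_n) : R :=
  \sum_(S : {set 'I_n} | i \in S) fourier R f S ^+ 2.

(* Influences are nonnegative, so the base value 0 only matters when n = 0. *)
Definition MaxInf (R : realType) (n : nat) (f : cube n -> bool) : R :=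
  \big[Num.max/0]_(i < n) Inf R f i.

(* A sensitive block is nonempty, so pairwise disjoint sensitive blocks are
   distinct and a family of them is the same as a set of them. *)
Definition bs (n : nat) (f : cube n -> bool) (x : cube n) : nat :=
  \max_(P : {set {set 'I_n}} |
      finset.trivIset P && [forall S in P, f x != f (flip x S)]) #|P|%N.

(* v(n) = 2^{-o(n)} as n tends to infinity *)
Definition two_pow_neg_o (R : realType) (v : nat -> R) : Prop :=
  exists e : nat -> R^o,
    e =o_\oo (fun n : nat => n%:R : R^o) /\
    \forall n \near \oo, v n = 2 `^ (- e n).

Lemma fourier_expansion (R : realType) (n : nat) (f : cube n -> bool)
    (x : cube n) :
  (f x)%:R = \sum_(S : {set 'I_n}) fourier R f S * \prod_(j in S) coord R x j.
Proof.
have card_neq0 : #|{: cube n}|%:R != 0 :> R.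
  by rewrite pnatr_eq0 -lt0n; apply/card_gt0P; exists x.
have ortho (y : cube n) :
    \sum_(S : {set 'I_n}) chi R S y * chi R S x = (y == x)%:R * #|{: cube n}|%:R.
  under eq_bigr do rewrite /chi -big_split /= big_mkcond /=.
  rewrite -(@bigA_distr R 0 1 *%R +%R _
             (fun i => coord R y i * coord R x i) (fun=> 1)) /=.
  case: eqVneq => [->|neq].
    rewrite mul1r card_ffun card_ord card_bool natrX.
    rewrite (eq_bigr (fun=> 2)) => [|i _].
      by rewrite prodr_const card_ord.
    by rewrite -expr2 /coord sqrr_sign.
  have [i neqi] : exists i, y i != x i.
    apply/existsP; rewrite -negb_forall; apply: contra neq => /forallP eqyx.
    by apply/eqP/ffunP => i; apply/eqP.
  rewrite mul0r (bigD1 i) //= /coord -signr_addb.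
  by move: neqi; rewrite -negb_add negbK => ->; rewrite expr1 addNr mul0r.
rewrite /fourier /expect.
under eq_bigr do rewrite mulrAC mulr_suml.
rewrite -mulr_suml exchange_big /=.
under eq_bigr => y _.
  under eq_bigr do rewrite -mulrA.
  rewrite -mulr_sumr ortho mulrA; over.
rewrite -mulr_suml mulfK // (bigD1 x) //= eqxx mulr1 big1 ?addr0 // => y /negPf ->.
by rewrite mulr0.
Qed.

(* Main.v *)
(** Write l = ln(1/tau)/2 and, for a set J of coordinates, let M_J(x) be the mean
    of f over the subcube of all points that agree with x off J.  The subcube is
    constantly 0 iff M_J(x) = 0.  We follow the moments
      q_j(J) = E_x (1 + e^l M_J(x))^(-2^j / l),
    which decrease when a coordinate is added to J.  Convexity bounds the total
    decrease of q_{j+1} over all added coordinates from below by discrete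
    derivatives of F = (1 + e^l M_J)^(-2^j / l): small jumps of M_J gain a
    factor l / 2^j, while a jump larger than M_J itself is so rare (because all
    influences are at most e^(-2l)) that, by hypercontractivity, it carries almost
    no Fourier weight up to level l / 16.  Hence
      sum_i (q_{j+1}(J) - q_{j+1}(J + i))
        >= c (l / 2^j) ln(q_{j+1} / q_j^2) q_{j+1}(J),
    and in terms of H_j = - ln q_j the drifts of H_1, ..., H_m telescope:
    sum_{j<m} (2 H_j - H_{j+1}) / 2^j = 2 (H_0 - H_m / 2^m).  Adding coordinates in
    random order, H_m exceeds 2^m / 4 after about (2^m + 1/Var) n / l steps with
    probability 3/4.  With 2^m of order lnln(1/tau) / Var this means that, for most
    J of that size k, f is constant on the subcube of x with probability at most
    2 exp(- 2^m / 4).  Finally, a point x of small block sensitivity has a constant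
    subcube for 3/4 of all J, since the n / k blocks of a random equipartition that
    are not constant give disjoint sensitive sets. *)

From mathcomp Require Import all_boot all_order all_algebra all_fingroup.
From mathcomp Require Import all_classical all_reals all_analysis.
(* [finset] is imported again, and [Defs] last, because the analysis library
   shadows [set0], [setP] and [coord]. *)
From mathcomp Require Import ring lra finset.
Require Import Defs.

Set Implicit Arguments.
Unset Strict Implicit.
Unset Printing Implicit Defensive.

Import Order.TTheory GRing.Theory Num.Theory.
Import numFieldNormedType.Exports.

Local Open Scope set_scope.
Local Open Scope ring_scope.

(** * Expectations, flips and characters on the cube *)

Lemma card_cube_neq0 (R : realType) n : #|{: cube n}|%:R != 0 :> R.
Proof. by rewrite card_ffun card_bool pnatr_eq0 expn_eq0. Qed.

Lemma card_cube_gt0 (R : realType) n : 0 < #|{: cube n}|%:R :> R.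
Proof. by rewrite lt0r card_cube_neq0 ler0n. Qed.

Lemma eq_expect (R : realType) n (g h : cube n -> R) :
  g =1 h -> expect g = expect h.
Proof. by move=> gh; rewrite /expect (eq_bigr h) // => x _; rewrite gh. Qed.

Lemma expectD (R : realType) n (g h : cube n -> R) :
  expect (fun x => g x + h x) = expect g + expect h.
Proof. by rewrite /expect big_split mulrDl. Qed.

Lemma expectZ (R : realType) n (c : R) (g : cube n -> R) :
  expect (fun x => c * g x) = c * expect g.
Proof. by rewrite /expect -mulr_sumr mulrA. Qed.

Lemma expectB (R : realType) n (g h : cube n -> R) :
  expect (fun x => g x - h x) = expect g - expect h.
Proof. by rewrite /expect sumrB mulrBl. Qed.

Lemma expect_cst (R : realType) n (c : R) : expect (fun _ : cube n => c) = c.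
Proof. by rewrite /expect sumr_const -[c *+ _]mulr_natr mulfK ?card_cube_neq0. Qed.

Lemma expect_sum (R : realType) n (I : finType) (P : pred I)
    (g : I -> cube n -> R) :
  expect (fun x => \sum_(i | P i) g i x) = \sum_(i | P i) expect (g i).
Proof. by rewrite /expect exchange_big /= mulr_suml. Qed.

Lemma ler_expect (R : realType) n (g h : cube n -> R) :
  (forall x, g x <= h x) -> expect g <= expect h.
Proof.
by move=> gh; rewrite /expect ler_pM2r ?invr_gt0 ?card_cube_gt0 // ler_sum.
Qed.

Lemma expect_ge0 (R : realType) n (g : cube n -> R) :
  (forall x, 0 <= g x) -> 0 <= expect g.
Proof. by move=> g0; rewrite -[leLHS](@expect_cst R n); exact: ler_expect. Qed.

Lemma flip_flip n (x : cube n) (S T : {set 'I_n}) :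
  flip (flip x S) T = flip (flip x T) S.
Proof. by apply/ffunP => j; rewrite !ffunE addbAC. Qed.

Lemma flipK n (S : {set 'I_n}) : involutive (fun x : cube n => flip x S).
Proof. by move=> x; apply/ffunP => j; rewrite !ffunE addbK. Qed.

Lemma expect_flip (R : realType) n (S : {set 'I_n}) (g : cube n -> R) :
  expect (fun x => g (flip x S)) = expect g.
Proof.
rewrite /expect; congr (_ / _).
by rewrite [RHS](reindex_inj (inv_inj (@flipK n S))).
Qed.

(** The quadratic E (t g + h)^2 in [t] is nonnegative; it is evaluated at its minimum t = - C /
    A. *)
Lemma expect_CS (R : realType) n (g h : cube n -> R) :
  expect (fun x => g x * h x) ^+ 2 <=
  expect (fun x => g x ^+ 2) * expect (fun x => h x ^+ 2).
Proof.
set A := expect (fun x => g x ^+ 2); set B := expect (fun x => h x ^+ 2).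
set C := expect _.
have A0 : 0 <= A by apply: expect_ge0 => x; exact: sqr_ge0.
have q t : 0 <= A * t ^+ 2 + 2 * t * C + B.
  suff -> : A * t ^+ 2 + 2 * t * C + B = expect (fun x => (t * g x + h x) ^+ 2).
    by apply: expect_ge0 => x; exact: sqr_ge0.
  rewrite mulrC -!expectZ -!expectD; apply: eq_expect => x; ring.
have [A_eq0|A_neq0] := eqVneq A 0.
  rewrite A_eq0 mul0r; have [->|C0] := eqVneq C 0; first by rewrite expr0n.
  (* When A = 0 the expression is affine in [t], and this value would make it equal to -1. *)
  have := q (- (B + 1) / (2 * C)); rewrite A_eq0.
  have -> : 0 * (- (B + 1) / (2 * C)) ^+ 2 + 2 * (- (B + 1) / (2 * C)) * C + B = -1.
    by field.
  by rewrite lerNr oppr0 ler10.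
have := q (- C / A).
have -> : A * (- C / A) ^+ 2 + 2 * (- C / A) * C + B = (A * B - C ^+ 2) / A.
  by field.
by rewrite pmulr_lge0 ?invr_gt0 ?lt0r ?A_neq0 // subr_ge0.
Qed.

Lemma coord_flip1 (R : realType) n (x : cube n) (i j : 'I_n) :
  coord R (flip x [set i]) j = (-1) ^+ (j == i) * coord R x j.
Proof. by rewrite /coord !ffunE inE signr_addb mulrC. Qed.

Lemma coord_sqr (R : realType) n (x : cube n) (i : 'I_n) : coord R x i ^+ 2 = 1.
Proof. by rewrite /coord sqrr_sign. Qed.

Lemma chi_flip1 (R : realType) n (S : {set 'I_n}) (x : cube n) (i : 'I_n) :
  chi R S (flip x [set i]) = (-1) ^+ (i \in S) * chi R S x.
Proof.
rewrite /chi; under eq_bigr do rewrite coord_flip1.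
rewrite big_split /=; congr (_ * _).
have [iS|iS] := boolP (i \in S).
  rewrite (bigD1 i) //= eqxx big1 ?mulr1 // => j /andP[_ /negPf ->] //.
by rewrite big1 // => j jS; case: eqP => // ji; rewrite -ji jS in iS.
Qed.

(** The sum over [S] factors as the product over i of (1 + y_i x_i); a coordinate where the points
    differ contributes a factor 0. *)
Lemma chi_dual (R : realType) n (x y : cube n) :
  \sum_(S : {set 'I_n}) chi R S y * chi R S x = (y == x)%:R * #|{: cube n}|%:R.
Proof.
under eq_bigr do rewrite /chi -big_split /= big_mkcond /=.
rewrite -(@bigA_distr R 0 1 *%R +%R _
           (fun i => coord R y i * coord R x i) (fun=> 1)) /=.
case: eqVneq => [->|neq].
  rewrite mul1r card_ffun card_ord card_bool natrX.
  under eq_bigr do rewrite -expr2 coord_sqr.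
  by rewrite prodr_const card_ord.
have [i neqi] : exists i, y i != x i.
  apply/existsP; rewrite -negb_forall; apply: contra neq => /forallP eqyx.
  by apply/eqP/ffunP => i; apply/eqP.
rewrite mul0r (bigD1 i) //= /coord -signr_addb.
by move: neqi; rewrite -negb_add negbK => ->; rewrite expr1 addNr mul0r.
Qed.

(** * Fourier analysis and hypercontractivity *)

(** The analogue of [fourier] for real-valued functions, such as powers of subcube averages. *)
Definition fcoef (R : realType) n (F : cube n -> R) (S : {set 'I_n}) : R :=
  expect (fun x => F x * chi R S x).

Lemma fcoef_expansion (R : realType) n (F : cube n -> R) (x : cube n) :
  F x = \sum_(S : {set 'I_n}) fcoef F S * chi R S x.
Proof.
rewrite /fcoef /expect; under eq_bigr do rewrite mulrAC mulr_suml.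
rewrite -mulr_suml exchange_big /=.
under eq_bigr => y _.
  under eq_bigr do rewrite -mulrA.
  rewrite -mulr_sumr chi_dual mulrA; over.
rewrite -mulr_suml mulfK ?card_cube_neq0 // (bigD1 x) //= eqxx mulr1.
by rewrite big1 ?addr0 // => y /negPf ->; rewrite mulr0.
Qed.

Lemma expect_mul_chi_sum (R : realType) n (F : cube n -> R)
    (P : pred {set 'I_n}) (c : {set 'I_n} -> R) :
  expect (fun x => F x * \sum_(S | P S) c S * chi R S x) =
  \sum_(S | P S) c S * fcoef F S.
Proof.
rewrite -(eq_expect (g := fun x => \sum_(S | P S) c S * (F x * chi R S x))).
  by rewrite expect_sum; apply: eq_bigr => S _; rewrite expectZ.
by move=> x; rewrite mulr_sumr; apply: eq_bigr => S _; ring.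
Qed.

Lemma Parseval (R : realType) n (F : cube n -> R) :
  expect (fun x => F x ^+ 2) = \sum_(S : {set 'I_n}) fcoef F S ^+ 2.
Proof.
rewrite -[RHS]expect_mul_chi_sum; apply: eq_expect => x.
by rewrite -fcoef_expansion expr2.
Qed.

Lemma fcoef_set0 (R : realType) n (F : cube n -> R) : fcoef F set0 = expect F.
Proof. by apply: eq_expect => x; rewrite /chi big_set0 mulr1. Qed.

Lemma fcoefD (R : realType) n (F G : cube n -> R) (S : {set 'I_n}) :
  fcoef (fun x => F x + G x) S = fcoef F S + fcoef G S.
Proof. by rewrite -expectD; apply: eq_expect => x; rewrite mulrDl. Qed.

(** Half the difference, so that the Fourier coefficients at sets containing [i] are kept
    unscaled. *)
Definition dif (R : realType) n (i : 'I_n) (F : cube n -> R) (x : cube n) : R :=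
  (F x - F (flip x [set i])) / 2.

Lemma fcoef_dif (R : realType) n (i : 'I_n) (F : cube n -> R) (S : {set 'I_n}) :
  fcoef (dif i F) S = (i \in S)%:R * fcoef F S.
Proof.
have -> : fcoef (dif i F) S =
    (fcoef F S - expect (fun x => F (flip x [set i]) * chi R S x)) / 2.
  by rewrite mulrC -expectB -expectZ; apply: eq_expect => x; rewrite /dif; field.
rewrite -(expect_flip [set i] (fun x => _ * _)).
rewrite (eq_expect (h := fun x => (-1) ^+ (i \in S) * (F x * chi R S x))).
  rewrite expectZ -/(fcoef F S).
  by case: (i \in S) => /=; rewrite ?expr1 ?expr0; field.
by move=> x; rewrite flipK chi_flip1; ring.
Qed.

(** Flipping coordinate [i] preserves the measure and negates the integrand. *)
Lemma expect_coord_eq0 (R : realType) n (i : 'I_n) (a b : cube n -> R) :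
  (forall x, a (flip x [set i]) = a x) ->
  (forall x, b (flip x [set i]) = b x) ->
  expect (fun x => a x * coord R x i * b x) = 0.
Proof.
move=> ha hb; set e := expect _; suff : e = - e by lra.
rewrite {1}/e -(expect_flip [set i]) -mulN1r -expectZ; apply: eq_expect => x.
by rewrite ha hb coord_flip1 eqxx expr1; ring.
Qed.

(** In the expanded fourth power the terms odd in x_i have mean 0, and Cauchy-Schwarz bounds the
    mixed term by A B; then A^2 + 6 A B + B^2 <= (A + 3 B)^2. *)
Lemma bonami_step (R : realType) n (i : 'I_n) (a b : cube n -> R) (A B : R) :
  (forall x, a (flip x [set i]) = a x) ->
  (forall x, b (flip x [set i]) = b x) ->
  0 <= A -> 0 <= B ->
  expect (fun x => a x ^+ 4) <= A ^+ 2 -> expect (fun x => b x ^+ 4) <= B ^+ 2 ->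
  expect (fun x => (a x + coord R x i * b x) ^+ 4) <= (A + 3 * B) ^+ 2.
Proof.
move=> ha hb A0 B0 hA hB.
have -> : expect (fun x => (a x + coord R x i * b x) ^+ 4) =
    expect (fun x => a x ^+ 4) + 6 * expect (fun x => a x ^+ 2 * b x ^+ 2)
    + expect (fun x => b x ^+ 4)
    + 4 * expect (fun x => a x ^+ 3 * coord R x i * b x)
    + 4 * expect (fun x => a x * coord R x i * b x ^+ 3).
  rewrite -!expectZ -!expectD; apply: eq_expect => x.
  have c2 := coord_sqr R x i.
  have c3 : coord R x i ^+ 3 = coord R x i by rewrite exprS c2 mulr1.
  have c4 : coord R x i ^+ 4 = 1 by rewrite -[4%N]/(2 * 2)%N exprM c2 expr1n.
  have -> : (a x + coord R x i * b x) ^+ 4 = a x ^+ 4 +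
     6 * coord R x i ^+ 2 * (a x ^+ 2 * b x ^+ 2) + coord R x i ^+ 4 * b x ^+ 4 +
     4 * (a x ^+ 3 * coord R x i * b x) +
     4 * (a x * coord R x i ^+ 3 * b x ^+ 3) by ring.
  by rewrite c2 c3 c4; ring.
rewrite !expect_coord_eq0; try (by move=> x; rewrite ?ha ?hb).
have m : expect (fun x => a x ^+ 2 * b x ^+ 2) <= A * B.
  have m0 : 0 <= expect (fun x => a x ^+ 2 * b x ^+ 2).
    by apply: expect_ge0 => x; rewrite mulr_ge0 ?sqr_ge0.
  have AB0 := mulr_ge0 A0 B0.
  rewrite -ler_sqr ?nnegrE //.
  apply: le_trans (expect_CS _ _) _; rewrite exprMn.
  apply: ler_pM; try (by apply: expect_ge0 => x; exact: sqr_ge0).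
    by under eq_expect do rewrite -exprM.
  by under eq_expect do rewrite -exprM.
by nra.
Qed.

(** Hypercontractivity from L2 to L4, by induction on #|U|: a coordinate [i] of [U] splits the
    polynomial into a + x_i b with [a] and [b] free of x_i. The factor 3 in front of B in
    [bonami_step] pays for the larger exponent of 3 at sets containing [i]. *)
Lemma bonami_subset (R : realType) n (U : {set 'I_n}) (c : {set 'I_n} -> R) :
  expect (fun x => (\sum_(S : {set 'I_n} | S \subset U) c S * chi R S x) ^+ 4) <=
  (\sum_(S : {set 'I_n} | S \subset U) 3 ^+ #|S| * c S ^+ 2) ^+ 2.
Proof.
move: {2}#|U| (erefl #|U|) => k; elim: k U c => [|k IH] U c cardU.
  have U0 : U = set0 by apply/eqP; rewrite -cards_eq0 cardU.
  have e (g : {set 'I_n} -> R) :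
      \sum_(S : {set 'I_n} | S \subset U) g S = g set0.
    by rewrite U0 (big_pred1 set0) // => S; rewrite subset0.
  under eq_expect do rewrite e /chi big_set0 mulr1.
  by rewrite expect_cst e cards0 expr0 mul1r -exprM.
have [i iU] : exists i, i \in U by apply/card_gt0P; rewrite cardU.
have cardU' : #|U :\ i| = k by move: cardU; rewrite (cardsD1 i U) iU => -[].
have split (g : {set 'I_n} -> R) :
    \sum_(S : {set 'I_n} | S \subset U) g S =
    \sum_(S : {set 'I_n} | S \subset U :\ i) g S +
    \sum_(S : {set 'I_n} | S \subset U :\ i) g (i |: S).
  rewrite (bigID (fun S : {set 'I_n} => i \in S)) /= addrC; congr (_ + _).
    by apply: eq_bigl => S; rewrite subsetD1.
  rewrite (reindex_onto (fun S => i |: S) (fun S => S :\ i)) /=; last first.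
    by move=> S /andP[_ iS]; rewrite setD1K.
  apply: eq_bigl => S; rewrite setU11 andbT subUset sub1set iU /= subsetD1.
  apply/andP/andP => -[SU iS]; split => //.
    by move/eqP: iS => <-; rewrite !inE eqxx.
  by rewrite setU1K.
pose a x := \sum_(S : {set 'I_n} | S \subset U :\ i) c S * chi R S x.
pose b x := \sum_(S : {set 'I_n} | S \subset U :\ i) c (i |: S) * chi R S x.
have inv (d : {set 'I_n} -> R) x :
    \sum_(S : {set 'I_n} | S \subset U :\ i) d S * chi R S (flip x [set i]) =
    \sum_(S : {set 'I_n} | S \subset U :\ i) d S * chi R S x.
  apply: eq_bigr => S; rewrite subsetD1 => /andP[_ /negPf iS].
  by rewrite chi_flip1 iS expr0 mul1r.
rewrite (eq_expect (h := fun x => (a x + coord R x i * b x) ^+ 4)); last first.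
  move=> x; rewrite split /a /b mulr_sumr; congr ((_ + _) ^+ _).
  apply: eq_bigr => S; rewrite subsetD1 => /andP[_ iS].
  by rewrite /chi big_setU1 //=; ring.
rewrite split.
have -> : \sum_(S : {set 'I_n} | S \subset U :\ i) 3 ^+ #|i |: S| * c (i |: S) ^+ 2 =
    3 * \sum_(S : {set 'I_n} | S \subset U :\ i) 3 ^+ #|S| * c (i |: S) ^+ 2.
  rewrite mulr_sumr; apply: eq_bigr => S; rewrite subsetD1 => /andP[_ iS].
  by rewrite cardsU1 iS exprD mulrA.
apply: bonami_step.
- by move=> x; exact: inv.
- by move=> x; exact: (inv (fun S => c (i |: S))).
- by apply: sumr_ge0 => S _; rewrite mulr_ge0 ?sqr_ge0 ?exprn_ge0.
- by apply: sumr_ge0 => S _; rewrite mulr_ge0 ?sqr_ge0 ?exprn_ge0.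
- exact: IH.
- exact: (IH _ (fun S => c (i |: S))).
Qed.

(** * Fourier weight at low levels *)

Definition wle (R : realType) n (F : cube n -> R) (d : nat) : R :=
  \sum_(S : {set 'I_n} | (#|S| <= d)%N) fcoef F S ^+ 2.

Definition lowdeg (R : realType) n (F : cube n -> R) (d : nat) (x : cube n) : R :=
  \sum_(S : {set 'I_n} | (#|S| <= d)%N) fcoef F S * chi R S x.

Lemma wle_ge0 (R : realType) n (F : cube n -> R) d : 0 <= wle F d.
Proof. by apply: sumr_ge0 => S _; exact: sqr_ge0. Qed.

Lemma expect_mul_lowdeg (R : realType) n (F : cube n -> R) d :
  expect (fun x => F x * lowdeg F d x) = wle F d.
Proof. by rewrite expect_mul_chi_sum. Qed.

Lemma bonami (R : realType) n (F : cube n -> R) d :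
  expect (fun x => lowdeg F d x ^+ 4) <= 9 ^+ d * wle F d ^+ 2.
Proof.
pose c (S : {set 'I_n}) : R := (#|S| <= d)%:R * fcoef F S.
have := bonami_subset setT c.
rewrite (eq_expect (h := fun x => lowdeg F d x ^+ 4)); last first.
  move=> x; congr (_ ^+ 4); rewrite /lowdeg [RHS]big_mkcond /=.
  apply: eq_big => S; first by rewrite subsetT.
  by rewrite /c; case: ifP; rewrite ?mul1r ?mul0r.
move/le_trans; apply.
rewrite [leRHS](_ : _ = (3 ^+ d * wle F d) ^+ 2); last first.
  by rewrite exprMn -exprM mulnC exprM; congr (_ ^+ _ * _); ring.
rewrite ler_sqr ?nnegrE ?mulr_ge0 ?wle_ge0 ?exprn_ge0 //; last first.
  by apply: sumr_ge0 => S _; rewrite mulr_ge0 ?sqr_ge0 ?exprn_ge0.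
rewrite /wle mulr_sumr [leRHS]big_mkcond /= (eq_bigl xpredT) => [|S]; last first.
  by rewrite subsetT.
apply: ler_sum => S _; rewrite /c; case: ifP => Sd.
  by rewrite mul1r ler_wpM2r ?sqr_ge0 // ler_weXn2l ?ler1n.
by rewrite mul0r expr0n mulr0.
Qed.

(** A level inequality. With g the low-degree part, W = E(F g). Cauchy-Schwarz for sqrt F and sqrt F
    g gives W^2 <= E F E(F g^2); a second one for F and g^2, with [bonami], gives E(F g^2)^2 <=
    E(F^2) 9^d W^2. Combine and cancel W^2. *)
Lemma wle_nonneg (R : realType) n (F : cube n -> R) d : (forall x, 0 <= F x) ->
  wle F d ^+ 2 <= expect F ^+ 2 * expect (fun x => F x ^+ 2) * 9 ^+ d.
Proof.
move=> F0; set g := lowdeg F d; set W := wle F d.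
have W0 : 0 <= W := wle_ge0 F d.
pose s x := Num.sqrt (F x).
have s2 x : s x ^+ 2 = F x by rewrite sqr_sqrtr.
have e1 : W ^+ 2 <= expect F * expect (fun x => F x * g x ^+ 2).
  have := expect_CS s (fun x => s x * g x).
  rewrite (eq_expect (h := fun x => F x * g x)); last first.
    by move=> x; rewrite mulrA -expr2 s2.
  rewrite expect_mul_lowdeg (eq_expect (g := fun x => s x ^+ 2) (h := F)) //.
  rewrite (eq_expect (g := fun x => _ ^+ 2) (h := fun x => F x * g x ^+ 2)) //.
  by move=> x; rewrite exprMn s2.
have e2 := expect_CS F (fun x => g x ^+ 2).
have e3 : expect (fun x => (g x ^+ 2) ^+ 2) <= 9 ^+ d * W ^+ 2.
  by under eq_expect do rewrite -exprM; exact: bonami.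
set a := expect F in e1 *; set b := expect (fun x => F x * g x ^+ 2) in e1 e2.
set q := expect (fun x => F x ^+ 2) in e2 *.
have a0 : 0 <= a by exact: expect_ge0.
have b0 : 0 <= b by apply: expect_ge0 => x; rewrite mulr_ge0 ?sqr_ge0.
have q0 : 0 <= q by apply: expect_ge0 => x; rewrite sqr_ge0.
have ab0 := mulr_ge0 a0 b0.
have e4 : W ^+ 2 * W ^+ 2 <= a ^+ 2 * q * 9 ^+ d * W ^+ 2.
  apply: (@le_trans _ _ ((a * b) ^+ 2)).
    by rewrite -expr2 ler_sqr ?nnegrE ?sqr_ge0.
  have -> : a ^+ 2 * q * 9 ^+ d * W ^+ 2 = a ^+ 2 * (q * (9 ^+ d * W ^+ 2)).
    by ring.
  rewrite exprMn; apply: ler_wpM2l; first exact: sqr_ge0.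
  exact: le_trans e2 (ler_wpM2l q0 e3).
have [->|Wn0] := eqVneq W 0.
  have n0 : 0 <= 9 ^+ d :> R by rewrite exprn_ge0.
  by rewrite expr0n; exact: mulr_ge0 (mulr_ge0 (sqr_ge0 a) q0) n0.
by rewrite -(@ler_pM2r _ (W ^+ 2)) // exprn_gt0 // lt0r Wn0.
Qed.

(** The same two Cauchy-Schwarz steps with the indicator of [b] yield W <= 3^d P^(3/2); [e] bounds
    the square root of P. *)
Lemma wle_indicator (R : realType) n (F : cube n -> R) (b : cube n -> bool) d
    (e : R) : 0 <= e -> (forall x, `|F x| <= (b x)%:R) -> Pr R b <= e ^+ 2 ->
  wle F d <= 3 ^+ d * Pr R b * e.
Proof.
move=> e0 Fb Pe; set P := Pr R b in Pe *; set g := lowdeg F d; set W := wle F d.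
have W0 : 0 <= W := wle_ge0 F d.
have P0 : 0 <= P by apply: expect_ge0 => x; exact: ler0n.
have bb x : (b x)%:R ^+ 2 = (b x)%:R :> R by case: (b x); rewrite ?expr1n ?expr0n.
have Eb : expect (fun x => (b x)%:R ^+ 2) = P by apply: eq_expect => x.
have e1 : W ^+ 2 <= P * expect (fun x => (b x)%:R * g x ^+ 2).
  have := expect_CS (fun x => (b x)%:R) (fun x => F x * g x).
  rewrite (eq_expect (h := fun x => F x * g x)); last first.
    move=> x; have := Fb x; case: (b x); first by rewrite mul1r.
    by rewrite normr_le0 => /eqP ->; rewrite !mul0r.
  rewrite expect_mul_lowdeg Eb => /le_trans; apply; rewrite ler_wpM2l //.
  apply: ler_expect => x; rewrite exprMn ler_wpM2r ?sqr_ge0 //.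
  by rewrite -bb -real_normK ?num_real // ler_sqr ?nnegrE.
have e2 := expect_CS (fun x => (b x)%:R) (fun x => g x ^+ 2).
have e3 : expect (fun x => (g x ^+ 2) ^+ 2) <= 9 ^+ d * W ^+ 2.
  by under eq_expect do rewrite -exprM; exact: bonami.
set c := expect (fun x => (b x)%:R * g x ^+ 2) in e1 e2.
have c0 : 0 <= c by apply: expect_ge0 => x; rewrite mulr_ge0 ?sqr_ge0.
rewrite Eb in e2.
have [->|Wn0] := eqVneq W 0.
  exact: mulr_ge0 (mulr_ge0 (exprn_ge0 _ (ler0n R 3)) P0) e0.
rewrite -ler_sqr ?nnegrE //; last first.
  exact: mulr_ge0 (mulr_ge0 (exprn_ge0 _ (ler0n R 3)) P0) e0.
rewrite -(@ler_pM2r _ (W ^+ 2)) ?exprn_gt0 ?lt0r ?Wn0 //.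
apply: (@le_trans _ _ ((P * c) ^+ 2)).
  by rewrite -expr2 ler_sqr ?nnegrE ?sqr_ge0 //; exact: mulr_ge0.
rewrite exprMn; apply: (@le_trans _ _ (P ^+ 2 * (P * (9 ^+ d * W ^+ 2)))).
  apply: ler_wpM2l; first exact: sqr_ge0.
  exact: le_trans e2 (ler_wpM2l P0 e3).
have -> : (3 ^+ d * P * e) ^+ 2 * W ^+ 2 = P ^+ 2 * (e ^+ 2 * (9 ^+ d * W ^+ 2)).
  rewrite [X in X * _](_ : _ = 9 ^+ d * P ^+ 2 * e ^+ 2); first by ring.
  by rewrite !exprMn -exprM mulnC exprM; congr (_ ^+ _ * _ * _); ring.
apply: ler_wpM2l; first exact: sqr_ge0.
apply: ler_wpM2r => //; apply: mulr_ge0; last exact: sqr_ge0.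
by rewrite exprn_ge0.
Qed.

Lemma wle_le_expect (R : realType) n (F : cube n -> R) d :
  wle F d <= expect (fun x => F x ^+ 2).
Proof.
rewrite Parseval /wle big_mkcond; apply: ler_sum => S _.
by case: ifP => // _; exact: sqr_ge0.
Qed.

Lemma sum_fcoef_above (R : realType) n (F : cube n -> R) d :
  \sum_(S : {set 'I_n} | (d < #|S|)%N) fcoef F S ^+ 2 =
  expect (fun x => F x ^+ 2) - wle F d.
Proof.
apply/eqP; rewrite eq_sym subr_eq addrC Parseval; apply/eqP.
rewrite (bigID (fun S : {set 'I_n} => (#|S| <= d)%N)) /=; congr (_ + _).
by apply: eq_bigl => S; rewrite ltnNge.
Qed.

Lemma wle0 (R : realType) n (F : cube n -> R) : wle F 0 = expect F ^+ 2.
Proof.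
rewrite /wle (big_pred1 set0) ?fcoef_set0 // => S.
by rewrite leqn0 cards_eq0.
Qed.

Lemma wleD (R : realType) n (F G : cube n -> R) d :
  wle (fun x => F x + G x) d <= 2 * wle F d + 2 * wle G d.
Proof.
rewrite /wle !mulr_sumr -big_split /=; apply: ler_sum => S _.
rewrite fcoefD; have := sqr_ge0 (fcoef F S - fcoef G S); nra.
Qed.

Lemma sum_fcoef_dif (R : realType) n (F : cube n -> R) (S : {set 'I_n}) :
  \sum_(i < n) fcoef (dif i F) S ^+ 2 = #|S|%:R * fcoef F S ^+ 2.
Proof.
rewrite (eq_bigr (fun i => (i \in S)%:R * fcoef F S ^+ 2)) => [|i _].
  rewrite -mulr_suml; congr (_ * _).
  by rewrite -natr_sum -sum1_card [in RHS]big_mkcond.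
by rewrite fcoef_dif exprMn; case: (i \in S); rewrite ?expr1n ?expr0n.
Qed.

(* The derivatives are cut into a part off [b i], bounded in L2, and a part on
   the rare event [b i], which has almost no weight at low levels. *)
Lemma tail_weight (R : realType) n (F : cube n -> R)
    (b : 'I_n -> cube n -> bool) (d1 d2 : nat) (s r : R) (D : 'I_n -> R) :
  (forall i, expect (fun x => ((~~ b i x)%:R * dif i F x) ^+ 2) <= s * D i) ->
  (forall i, wle (fun x => (b i x)%:R * dif i F x) d2 <= r * D i) ->
  (forall i, expect (fun x => dif i F x ^+ 2) <= D i) ->
  \sum_(S : {set 'I_n} | (d1 < #|S|)%N) fcoef F S ^+ 2 <=
  (2 * (s + r) / d1.+1%:R + d2.+1%:R^-1) * \sum_(i < n) D i.
Proof.
move=> hs hr hD.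
(* Up to level [d2] both parts of each derivative are small. Above it only the plain L2 bound [hi]
   is available, but there |S| >= d2 + 1. *)
have lo : \sum_(S : {set 'I_n} | (#|S| <= d2)%N) #|S|%:R * fcoef F S ^+ 2 <=
    2 * (s + r) * \sum_(i < n) D i.
  under eq_bigr do rewrite -sum_fcoef_dif.
  rewrite exchange_big mulr_sumr /=; apply: ler_sum => i _; rewrite -/(wle _ _).
  have -> : wle (dif i F) d2 =
      wle (fun x => (~~ b i x)%:R * dif i F x + (b i x)%:R * dif i F x) d2.
    apply: eq_bigr => S _; congr (_ ^+ 2); apply: eq_expect => x.
    by case: (b i x); rewrite /=; ring.
  apply: le_trans (wleD _ _ _) _.
  have := hs i; have := hr i.
  have := wle_le_expect (fun x => (~~ b i x)%:R * dif i F x) d2; nra.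
have hi : \sum_(S : {set 'I_n}) #|S|%:R * fcoef F S ^+ 2 <= \sum_(i < n) D i.
  under eq_bigr do rewrite -sum_fcoef_dif.
  rewrite exchange_big /=; apply: ler_sum => i _.
  by rewrite -Parseval; exact: hD.
have p1 : 0 < d1.+1%:R^-1 :> R by rewrite invr_gt0 ltr0n.
have p2 : 0 < d2.+1%:R^-1 :> R by rewrite invr_gt0 ltr0n.
set T := \sum_(i < n) D i in lo hi *.
have -> : (2 * (s + r) / d1.+1%:R + d2.+1%:R^-1) * T =
  d1.+1%:R^-1 * (2 * (s + r) * T) + d2.+1%:R^-1 * T by ring.
apply: le_trans (lerD (ler_wpM2l (ltW p1) lo) (ler_wpM2l (ltW p2) hi)).
rewrite !mulr_sumr [X in _ <= X + _]big_mkcond [leLHS]big_mkcond -big_split /=.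
apply: ler_sum => S _; have f0 := sqr_ge0 (fcoef F S).
have key (d : nat) : (d < #|S|)%N ->
    fcoef F S ^+ 2 <= d.+1%:R^-1 * (#|S|%:R * fcoef F S ^+ 2).
  move=> dS; rewrite mulrA -[leLHS]mul1r ler_wpM2r // mulrC.
  by rewrite ler_pdivlMr ?ltr0n // mul1r ler_nat.
have t0 (d : nat) : 0 <= d.+1%:R^-1 * (#|S|%:R * fcoef F S ^+ 2).
  by apply: mulr_ge0; [rewrite invr_ge0 ler0n|apply: mulr_ge0].
case: ifP => dS; case: ifP => dS'.
- by apply: le_trans (key _ dS) _; rewrite lerDl.
- by rewrite add0r key // ltnNge dS'.
- by rewrite addr_ge0.
- by rewrite add0r.
Qed.

(** * Convexity of negative powers *)

(** The power y^(-t) for y > 0. *)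
Definition pot (R : realType) (t y : R) : R := expR (- (t * ln y)).

Lemma pot_gt0 (R : realType) (t y : R) : 0 < pot t y.
Proof. exact: expR_gt0. Qed.

Lemma pot2 (R : realType) (t y : R) : pot (2 * t) y = pot t y ^+ 2.
Proof. by rewrite /pot expr2 -expRD; congr expR; ring. Qed.

Lemma expRN_le (R : realType) (x : R) : 0 <= x -> expR (- x) <= (1 + x)^-1.
Proof.
by move=> x0; rewrite expRN lef_pV2 ?posrE ?expR_gt0 ?expR_ge1Dx //; lra.
Qed.

(* The defect of convexity of [pot (2 * t)]; the second term is what makes
   small jumps pay an extra factor [1 / t]. *)
Lemma pot_convex_defect (R : realType) (t p m : R) :
  0 < t -> t <= 1 -> 0 < p -> 0 < m ->
  (pot t p - pot t m) ^+ 2 / 2 +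
    t / 2 * ((p - m) / (p + m)) ^+ 2 * (pot t p * pot t m) <=
  (pot (2 * t) p + pot (2 * t) m) / 2 - pot (2 * t) ((p + m) / 2).
Proof.
move=> t0 t1 p0 m0; set c := (p + m) / 2; set r2 := ((p - m) / (p + m)) ^+ 2.
have c0 : 0 < c by rewrite /c; lra.
have pm0 : p + m != 0 by apply/lt0r_neq0; lra.
have r20 : 0 <= r2 by exact: sqr_ge0.
have r2E : p * m = c ^+ 2 * (1 - r2) by rewrite /c /r2; field.
have r21 : r2 < 1.
  have : 0 < c ^+ 2 * (1 - r2) by rewrite -r2E mulr_gt0.
  by rewrite pmulr_rgt0 ?exprn_gt0 // subr_gt0.
(* Since p m = c^2 (1 - r2), the logarithm of the arithmetic mean exceeds the mean of the logarithms
   by at least r2 / 2. *)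
have lnr : ln p + ln m <= 2 * ln c - r2.
  rewrite -lnM ?posrE // r2E lnM ?posrE ?exprn_gt0 ?subr_gt0 //.
  rewrite lnXn // -mulr_natl; have := @le_ln1Dx R (- r2); lra.
have RE : pot t p * pot t m = expR (- (t * (ln p + ln m))).
  by rewrite /pot -expRD; congr expR; ring.
(* With a = pot t p and b = pot t m, the mean of the two end values is (a - b)^2 / 2 + a b, so the
   value at [c] is to be compared with a b. *)
have cle : pot (2 * t) c <= pot t p * pot t m * (1 + t * r2)^-1.
  apply: (@le_trans _ _ (pot t p * pot t m * expR (- (t * r2)))).
    by rewrite RE -expRD /pot ler_expR; nra.
  apply: ler_wpM2l; first by rewrite mulr_ge0 // ltW ?pot_gt0.
  by apply: expRN_le; rewrite mulr_ge0 // ltW.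
have tr : (1 + t * r2)^-1 <= 1 - t / 2 * r2.
  have tr0 : 0 <= t * r2 by rewrite mulr_ge0 // ltW.
  have tr1 : t * r2 <= 1 by nra.
  rewrite -[leLHS]mul1r ler_pdivrMr; nra.
have R0 : 0 <= pot t p * pot t m by rewrite mulr_ge0 // ltW ?pot_gt0.
rewrite !pot2 -pot2; set R2 := pot t p * pot t m in cle R0 *.
have := ler_wpM2l R0 tr; rewrite !pot2 in cle *; rewrite /R2 in cle *; nra.
Qed.

(** For m <= p the jump condition says p <= 3 m, so ln p - ln m <= 4 r with r = (p - m) / (p + m).
    Hence b - a <= 4 t r b and b <= 3 a for the two powers a <= b, and (b - a)^2 / 4 <= 12 t^2 r^2 a
    b, which is 24 t times the second term of the convexity defect. *)
Lemma pot_smooth_jump (R : realType) (t p m : R) :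
  0 < t -> t <= 1 -> 0 < p -> 0 < m -> `|p - m| <= (p + m) / 2 ->
  ((pot t p - pot t m) / 2) ^+ 2 <=
  24 * t * ((pot (2 * t) p + pot (2 * t) m) / 2 - pot (2 * t) ((p + m) / 2)).
Proof.
move=> t0 t1; wlog mp : p m / m <= p => [H p0 m0 pm|p0 m0].
  have [mp|/ltW pm'] := leP m p; first exact: H.
  have := H m p pm' m0 p0; rewrite distrC [m + p]addrC => /(_ pm).
  by rewrite -[pot t m - _]opprB mulNr sqrrN [pot (2 * t) m + _]addrC.
rewrite ger0_norm ?subr_ge0 // => pm.
have dfc := pot_convex_defect t0 t1 p0 m0.
apply: (@le_trans _ _ (24 * t * (t / 2 * ((p - m) / (p + m)) ^+ 2 *
   (pot t p * pot t m)))); last first.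
  rewrite ler_pM2l; last by lra.
  by apply: le_trans dfc; rewrite lerDr divr_ge0 ?sqr_ge0.
have pm0 : p + m != 0 by apply/lt0r_neq0; lra.
set r := (p - m) / (p + m); have r0 : 0 <= r by rewrite divr_ge0 //; lra.
have lnpm : ln p - ln m <= p / m - 1.
  rewrite -ln_div ?posrE //.
  have := @le_ln1Dx R (p / m - 1).
  rewrite (_ : 1 + (p / m - 1) = p / m); [apply | by ring].
  by have : 0 < p / m by [rewrite divr_gt0]; lra.
have lnr : ln p - ln m <= 4 * r.
  apply: le_trans lnpm _; rewrite -subr_ge0.
  rewrite (_ : _ - _ = (p - m) * (3 * m - p) / (m * (p + m))); last first.
    by rewrite /r; field; rewrite pm0 gt_eqF.
  by rewrite divr_ge0 ?mulr_ge0 //; lra.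
have ln0 : 0 <= ln p - ln m by rewrite subr_ge0 ler_ln ?posrE.
set a := pot t p; set b := pot t m.
have ab : a = b * expR (- (t * (ln p - ln m))).
  by rewrite /a /b /pot -expRD; congr expR; ring.
have b0 : 0 < b by exact: pot_gt0.
have a0 : 0 < a by exact: pot_gt0.
have bale : b - a <= b * (4 * t * r).
  have := expR_ge1Dx (- (t * (ln p - ln m))); rewrite ab.
  have : t * (ln p - ln m) <= t * (4 * r) by rewrite ler_pM2l.
  nra.
have ale : a <= b.
  by rewrite ab -[leRHS]mulr1 ler_pM2l // expR_le1 oppr_le0 mulr_ge0 // ltW.
have b3a : b <= 3 * a.
  rewrite (_ : b = a * expR (t * (ln p - ln m))); last first.
    by rewrite ab -mulrA -expRD addrC subrr expR0 mulr1.
  rewrite mulrC ler_pM2r //; apply: (@le_trans _ _ (expR (ln p - ln m))).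
    by rewrite ler_expR -[leRHS]mul1r ler_wpM2r.
  by rewrite -ln_div ?posrE // lnK ?posrE ?divr_gt0 // ler_pdivrMr //; lra.
have h1 : (b - a) ^+ 2 <= (b * (4 * t * r)) ^+ 2.
  have x0 : 0 <= b * (4 * t * r) by apply: le_trans bale; rewrite subr_ge0.
  by rewrite ler_sqr ?nnegrE ?subr_ge0.
have h2 : b * b <= 3 * a * b by rewrite ler_pM2r.
have h3 := ler_wpM2r (sqr_ge0 (t * r)) h2.
nra.
Qed.

(** Here (p - m) / (p + m) has modulus at least 1/2, so the second term of the convexity defect
    suffices. *)
Lemma pot_large_jump (R : realType) (t p m L : R) :
  0 < t -> t <= 1 -> 0 < p -> 0 < m -> ln p <= L -> ln m <= L ->
  (p + m) / 2 <= `|p - m| ->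
  t / 8 * expR (- (2 * t * L)) <=
  (pot (2 * t) p + pot (2 * t) m) / 2 - pot (2 * t) ((p + m) / 2).
Proof.
move=> t0 t1 p0 m0 pL mL pm.
apply: le_trans (pot_convex_defect t0 t1 p0 m0).
apply: (@le_trans _ _ (t / 2 * ((p - m) / (p + m)) ^+ 2 *
   (pot t p * pot t m))); last by rewrite lerDr divr_ge0 ?sqr_ge0.
have pm0 : 0 < p + m by lra.
have r4 : 1 / 4 <= ((p - m) / (p + m)) ^+ 2.
  rewrite expr_div_n ler_pdivlMr ?exprn_gt0 //.
  have : ((p + m) / 2) ^+ 2 <= `|p - m| ^+ 2 by rewrite ler_sqr ?nnegrE //; lra.
  by rewrite real_normK ?num_real //; nra.
have R2 : expR (- (2 * t * L)) <= pot t p * pot t m.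
  by rewrite /pot -expRD ler_expR; nra.
rewrite (_ : t / 8 = t / 2 * (1 / 4)); last by field.
by rewrite ler_pM ?expR_ge0 ?mulr_ge0 ?ler_pM2l //; lra.
Qed.

Lemma expect_exchange (R : realType) n (g : cube n -> cube n -> R) :
  expect (fun x => expect (g x)) = expect (fun z => expect (fun x => g x z)).
Proof.
rewrite /expect -!mulr_suml; congr (_ / _ / _); exact: exchange_big.
Qed.

Lemma ler_norm_expect (R : realType) n (g : cube n -> R) :
  `|expect g| <= expect (fun x => `|g x|).
Proof.
rewrite /expect normrM [X in _ * X <= _]ger0_norm ?invr_ge0 ?ler0n //.
by rewrite ler_wpM2r ?invr_ge0 ?ler0n // ler_norm_sum.
Qed.

Lemma markov_expect (R : realType) n (b : cube n -> bool) (g : cube n -> R) :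
  (forall x, 0 <= g x) -> (forall x, b x -> 1 <= g x) -> Pr R b <= expect g.
Proof.
by move=> g0 bg; apply: ler_expect => x; case: (boolP (b x)) => [/bg|_].
Qed.

(** * Averages over subcubes *)

(** Flipping a uniformly random subset of [J] makes the coordinates in [J] uniform, so this is the
    average M_J of [f] over the subcube of [x]. *)
Definition mavg (R : realType) n (f : cube n -> bool) (J : {set 'I_n})
    (x : cube n) : R :=
  expect (fun z : cube n => (f (flip x [set j in J | z j]))%:R).

Lemma mavg_ge0 (R : realType) n (f : cube n -> bool) J x : 0 <= mavg R f J x.
Proof. by apply: expect_ge0 => z; exact: ler0n. Qed.

Lemma mavg_le1 (R : realType) n (f : cube n -> bool) J x : mavg R f J x <= 1.
Proof.
by rewrite -[leRHS](@expect_cst R n); apply: ler_expect => z; rewrite lern1 leq_b1.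
Qed.

Lemma expect_mavg (R : realType) n (f : cube n -> bool) J :
  expect (mavg R f J) = expect (fun x => (f x)%:R).
Proof.
rewrite /mavg expect_exchange -[RHS](@expect_cst R n); apply: eq_expect => z.
exact: (expect_flip _ (fun x => (f x)%:R)).
Qed.

(** Pair [z] with its flip at [i]: exactly one of the two also flips [x] at [i]. The pairing is done
    over J minus [i], which covers [i] inside and outside [J]. *)
Lemma mavg_setU1 (R : realType) n (f : cube n -> bool) J (i : 'I_n) x :
  mavg R f (i |: J) x = (mavg R f J x + mavg R f J (flip x [set i])) / 2.
Proof.
pose S (A : {set 'I_n}) (z : cube n) := [set j in A | z j].
have E (z : cube n) :
    (f (flip x (S (i |: J) z)))%:R + (f (flip x (S (i |: J) (flip z [set i]))))%:R =
    (f (flip x (S (J :\ i) z)))%:R + (f (flip (flip x [set i]) (S (J :\ i) z)))%:R :> R.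
  have e0 (w : cube n) : w i = false -> (forall j, j != i -> w j = z j) ->
      flip x (S (i |: J) w) = flip x (S (J :\ i) z).
    move=> wi wz; apply/ffunP => j; rewrite !ffunE !inE.
    by case: eqVneq => [->|ji] /=; rewrite ?wi ?wz.
  have e1 (w : cube n) : w i = true -> (forall j, j != i -> w j = z j) ->
      flip x (S (i |: J) w) = flip (flip x [set i]) (S (J :\ i) z).
    move=> wi wz; apply/ffunP => j; rewrite !ffunE !inE.
    by case: eqVneq => [->|ji] /=; rewrite ?wi ?wz ?addbF.
  have zi : flip z [set i] i = ~~ z i by rewrite !ffunE inE eqxx addbT.
  have zj j : j != i -> flip z [set i] j = z j.
    by move=> ji; rewrite !ffunE inE (negPf ji) addbF.
  case: (boolP (z i)) => zI.
    by rewrite e1 // (e0 (flip z _)) ?zi ?zI // addrC.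
  by rewrite (e0 z) ?(negPf zI) // (e1 (flip z _)) ?zi ?zI.
have F (A : {set 'I_n}) y : mavg R f A y =
    (expect (fun z => (f (flip y (S A z)))%:R) +
     expect (fun z => (f (flip y (S A (flip z [set i]))))%:R)) / 2.
  rewrite (expect_flip [set i] (fun z => (f (flip y (S A z)))%:R)) /mavg.
  by rewrite -/(S _ _); field.
have mD : mavg R f (i |: J) x =
    (mavg R f (J :\ i) x + mavg R f (J :\ i) (flip x [set i])) / 2.
  rewrite F; congr (_ / 2).
  by rewrite /mavg -!expectD; apply: eq_expect => z; exact: E.
have [iJ|iJ] := boolP (i \in J); last first.
  rewrite mD (_ : J :\ i = J) //; apply/setP => j; rewrite !inE.
  by case: eqVneq => [->|]; rewrite ?(negPf iJ).
have JE : i |: J = J by apply/setUidPr; rewrite sub1set.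
rewrite JE in mD.
have -> : mavg R f J (flip x [set i]) = mavg R f J x.
  rewrite /mavg -(expect_flip [set i] (fun z => (f (flip x _))%:R)).
  apply: eq_expect => z; congr ((f _)%:R); apply/ffunP => j.
  rewrite !ffunE !inE !ffunE inE; case: eqVneq => [->|_]; last by rewrite !addbF.
  by rewrite iJ; case: (x i); case: (z i).
by rewrite JE; field.
Qed.

Lemma Inf_dif (R : realType) n (f : cube n -> bool) (i : 'I_n) :
  Inf R f i = expect (fun x => dif i (fun y => (f y)%:R : R) x ^+ 2).
Proof.
rewrite Parseval /Inf big_mkcond /=; apply: eq_bigr => S _.
by rewrite fcoef_dif; case: (i \in S); rewrite ?mul1r // mul0r expr0n.
Qed.

(** The difference of two bits is 0, 1 or -1, so its mean modulus is its mean square, that is 4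
    Inf_i; averaging over flips inside [J] does not increase it. *)
Lemma mavg_diff (R : realType) n (f : cube n -> bool) J (i : 'I_n) :
  expect (fun x => `|mavg R f J x - mavg R f J (flip x [set i])|) <=
  4 * Inf R f i.
Proof.
pose g x : R := `|(f x)%:R - (f (flip x [set i]))%:R|.
have -> : 4 * Inf R f i = expect g.
  rewrite Inf_dif -expectZ; apply: eq_expect => x; rewrite /dif /g.
  by case: (f x); case: (f _); rewrite /= ?subrr ?normr0 ?subr0 ?sub0r ?normrN ?normr1;
     field.
apply: (@le_trans _ _ (expect (fun x => expect (fun z : cube n =>
    g (flip x [set j in J | z j]))))).
  apply: ler_expect => x; rewrite /mavg -expectB.
  by apply: le_trans (ler_norm_expect _) _; apply: ler_expect => z;
    rewrite /g flip_flip.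
rewrite expect_exchange -[leRHS](@expect_cst R n); apply: ler_expect => z.
by rewrite (expect_flip _ g).
Qed.

(** * Negative moments of subcube averages and their decrease *)

Definition nrm (R : realType) (l : R) n (f : cube n -> bool) J x : R :=
  1 + mavg R f J x * expR l.

Definition qpot (R : realType) (l : R) n (f : cube n -> bool) (t : R) J : R :=
  expect (fun x => pot t (nrm l f J x)).

Lemma nrm_ge1 (R : realType) (l : R) n (f : cube n -> bool) J x :
  1 <= nrm l f J x.
Proof. by rewrite lerDl mulr_ge0 ?mavg_ge0 ?expR_ge0. Qed.

Lemma nrm_gt0 (R : realType) (l : R) n (f : cube n -> bool) J x :
  0 < nrm l f J x.
Proof. exact: lt_le_trans (nrm_ge1 l f J x). Qed.

Lemma ln_nrm_le (R : realType) (l : R) n (f : cube n -> bool) J x :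
  1 <= l -> ln (nrm l f J x) <= 2 * l.
Proof.
move=> l1; rewrite -[leRHS]expRK ler_ln ?posrE ?expR_gt0 ?nrm_gt0 //.
rewrite mulr_natl mulr2n expRD.
have e2 : 2 <= expR l by have := expR_ge1Dx l; lra.
have := mavg_le1 R f J x; have := mavg_ge0 R f J x; rewrite /nrm; nra.
Qed.

Lemma nrm_setU1 (R : realType) (l : R) n (f : cube n -> bool) J (i : 'I_n) x :
  nrm l f (i |: J) x = (nrm l f J x + nrm l f J (flip x [set i])) / 2.
Proof. by rewrite /nrm mavg_setU1; field. Qed.

Lemma pot_le1 (R : realType) (t y : R) : 0 <= t -> 1 <= y -> pot t y <= 1.
Proof.
by move=> t0 y1; rewrite /pot expR_le1 oppr_le0 mulr_ge0 ?ln_ge0.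
Qed.

Lemma qpot_le1 (R : realType) (l : R) n (f : cube n -> bool) (t : R) J :
  0 <= t -> qpot l f t J <= 1.
Proof.
move=> t0; rewrite -[leRHS](@expect_cst R n); apply: ler_expect => x.
by rewrite pot_le1 ?nrm_ge1.
Qed.

Lemma qpot_ge (R : realType) (l : R) n (f : cube n -> bool) (t : R) J :
  0 <= t -> 1 <= l -> expR (- (2 * t * l)) <= qpot l f t J.
Proof.
move=> t0 l1; rewrite -[leLHS](@expect_cst R n); apply: ler_expect => x.
rewrite /pot ler_expR lerN2 -mulrA mulrCA ler_wpM2l //; exact: ln_nrm_le.
Qed.

Lemma qpot_gt0 (R : realType) (l : R) n (f : cube n -> bool) (t : R) J :
  0 <= t -> 1 <= l -> 0 < qpot l f t J.
Proof.
by move=> t0 l1; apply: lt_le_trans (qpot_ge f J t0 l1); exact: expR_gt0.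
Qed.

(** Adding [i] averages the base over [x] and its neighbour, so the decrease is an expected
    convexity defect. *)
Lemma qpot_decr (R : realType) (l : R) n (f : cube n -> bool) (t : R) J i :
  qpot l f t J - qpot l f t (i |: J) =
  expect (fun x => (pot t (nrm l f J x) + pot t (nrm l f J (flip x [set i]))) / 2
    - pot t ((nrm l f J x + nrm l f J (flip x [set i])) / 2)).
Proof.
rewrite expectB; congr (_ - _); last first.
  by apply: eq_expect => x; rewrite nrm_setU1.
rewrite (eq_expect (h := fun x => 2^-1 * (pot t (nrm l f J x) +
   pot t (nrm l f J (flip x [set i]))))); last by move=> x; rewrite mulrC.
rewrite expectZ expectD (expect_flip [set i] (fun x => pot t (nrm l f J x))).
by rewrite -/(qpot l f t J); field.
Qed.

Lemma pot_gap_ge0 (R : realType) (t p m : R) :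
  0 < t -> 0 <= t / 2 * ((p - m) / (p + m)) ^+ 2 * (pot t p * pot t m).
Proof.
move=> t0; apply: mulr_ge0; last by rewrite mulr_ge0 // ltW // pot_gt0.
by rewrite mulr_ge0 ?sqr_ge0 // divr_ge0 // ltW.
Qed.

Lemma pot_defect_ge0 (R : realType) (t p m : R) :
  0 < t -> t <= 1 -> 0 < p -> 0 < m ->
  0 <= (pot (2 * t) p + pot (2 * t) m) / 2 - pot (2 * t) ((p + m) / 2).
Proof.
move=> t0 t1 p0 m0; apply: le_trans (pot_convex_defect t0 t1 p0 m0).
by rewrite addr_ge0 ?pot_gap_ge0 // divr_ge0 ?sqr_ge0.
Qed.

Lemma qpot_mono (R : realType) (l : R) n (f : cube n -> bool) (t : R) J i :
  0 < t -> t <= 2 -> qpot l f t (i |: J) <= qpot l f t J.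
Proof.
move=> t0 t1; rewrite -subr_ge0 qpot_decr; apply: expect_ge0 => x.
have -> : t = 2 * (t / 2) by field.
by apply: pot_defect_ge0; rewrite ?nrm_gt0 //; lra.
Qed.

Definition large_jump (R : realType) (l : R) n (f : cube n -> bool) J i x : bool :=
  (nrm l f J x + nrm l f J (flip x [set i])) / 2 <
  `|nrm l f J x - nrm l f J (flip x [set i])|.

(** Both bases are at least 1, so a large jump changes M_J by at least e^(-l). Markov with
    [mavg_diff] gives 4 e^(-l), written as a square for [wle_indicator]. *)
Lemma Pr_large_jump (R : realType) (l : R) n (f : cube n -> bool) J i :
  Inf R f i <= expR (- (2 * l)) ->
  Pr R (large_jump l f J i) <= (2 * expR (- (l / 2))) ^+ 2.
Proof.
move=> fi; apply: (@le_trans _ _ (expect (fun x => expR l *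
   `|mavg R f J x - mavg R f J (flip x [set i])|))).
  apply: markov_expect => x; first by rewrite mulr_ge0 ?expR_ge0.
  rewrite /large_jump => /ltW h.
  rewrite -[expR l]ger0_norm ?expR_ge0 // -normrM.
  have := nrm_ge1 l f J x; have := nrm_ge1 l f J (flip x [set i]).
  rewrite (_ : expR l * _ = nrm l f J x - nrm l f J (flip x [set i])); first lra.
  by rewrite /nrm; ring.
rewrite expectZ; have := mavg_diff R f J i => h.
apply: (@le_trans _ _ (expR l * (4 * expR (- (2 * l))))).
  by rewrite ler_wpM2l ?expR_ge0 //; lra.
rewrite mulrCA -expRD exprMn -expRM_natl.
by rewrite (_ : l - 2 * l = 2 * - (l / 2)); [lra|field].
Qed.

(** Here 3^d <= e^(l/8) and e^(-4 t l) >= e^(-l/8), which leaves 16 <= t^2 e^(l/4); this follows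
    from t l >= 1 and 16 l^2 <= e^(l/4). *)
Lemma jump_constants (R : realType) (l t : R) (d : nat) :
  1024 <= l -> l^-1 <= t -> t <= 1 / 32 -> d%:R <= l / 16 ->
  3 ^+ d * (2 * expR (- (l / 2))) <= t * (t / 8 * expR (- (2 * t * (2 * l)))).
Proof.
move=> l0 lt t1 dl.
have t0 : 0 < t by apply: lt_le_trans lt; rewrite invr_gt0; lra.
have d3 : 3 ^+ d <= expR (l / 8) :> R.
  apply: (@le_trans _ _ (expR (d%:R * 2))).
    rewrite expRM_natl lerXn2r ?nnegrE ?expR_ge0 //.
    by have := expR_ge1Dx (2 : R); lra.
  by rewrite ler_expR; lra.
have e4 : 16 * l ^+ 2 <= expR (l / 4).
  have -> : l / 4 = 4%:R * (l / 16) by field.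
  rewrite expRM_natl; have h := expR_ge1Dx (l / 16).
  apply: (@le_trans _ _ ((l / 16) ^+ 4)).
    rewrite [in leLHS](_ : l = 16 * (l / 16)); last by field.
    set y := l / 16; have y64 : 64 <= y by rewrite /y; lra.
    have yy : 64 * y <= y * y by rewrite ler_wpM2r //; lra.
    have y0 : 0 <= y * y by rewrite -expr2 sqr_ge0.
    have := ler_wpM2r y0 (ltac:(lra) : 4096 <= y * y).
    by rewrite -[y ^+ 4]/(y * (y * (y * y))); lra.
  by rewrite lerXn2r ?nnegrE ?expR_ge0 //; lra.
have tl : 1 <= t * l by rewrite -ler_pdivrMr ?mul1r //; lra.
have tl2 : 1 <= t ^+ 2 * l ^+ 2 by rewrite -exprMn exprn_ege1.
have X : expR (l / 8) * (2 * expR (- (l / 2))) <=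
    t ^+ 2 / 8 * expR (- (l / 8)).
  have -> : expR (- (l / 8)) = expR (l / 8) * expR (- (l / 2)) * expR (l / 4).
    by rewrite -!expRD; congr expR; field.
  rewrite mulrCA [2 * _]mulrC [leRHS]mulrCA ler_wpM2l ?mulr_ge0 ?expR_ge0 //.
  have := ler_wpM2l (sqr_ge0 t) e4; nra.
apply: le_trans (le_trans X _).
  by rewrite ler_wpM2r // mulr_ge0 ?expR_ge0.
rewrite mulrA (_ : t * (t / 8) = t ^+ 2 / 8); last by field.
rewrite ler_wpM2l ?divr_ge0 ?sqr_ge0 // ler_expR; nra.
Qed.

(** [tail_weight] with the large jumps as rare events and D i the decrease caused by adding [i]: s =
    24 t comes from [pot_smooth_jump], r = t from [wle_indicator] against [pot_large_jump], and d2 =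
    floor(l / 16). *)
Lemma qpot_tail (R : realType) (l t : R) n (f : cube n -> bool) J (d : nat) :
  1024 <= l -> l^-1 <= t -> t <= 1 / 32 ->
  (forall i, Inf R f i <= expR (- (2 * l))) ->
  qpot l f (2 * t) J - wle (fun x => pot t (nrm l f J x)) d <=
  (50 * t / d.+1%:R + 16 / l) *
    \sum_(i < n) (qpot l f (2 * t) J - qpot l f (2 * t) (i |: J)).
Proof.
move=> l0 lt t1 fi; set F := fun x => pot t (nrm l f J x).
have t0 : 0 < t by apply: lt_le_trans lt; rewrite invr_gt0; lra.
pose e := Num.truncn (l / 16).
have l16 : 0 <= l / 16 by lra.
have /andP[el le] := truncn_itv l16; rewrite -/e in el le.
pose D i := qpot l f (2 * t) J - qpot l f (2 * t) (i |: J).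
have defect i x := pot_convex_defect t0 (le_trans t1 (ltac:(lra) : 1 / 32 <= 1 :> R))
  (nrm_gt0 l f J x) (nrm_gt0 l f J (flip x [set i])).
have D0 i : 0 <= D i by rewrite subr_ge0 qpot_mono //; lra.
have h : \sum_(S : {set 'I_n} | (d < #|S|)%N) fcoef F S ^+ 2 <=
    (2 * (24 * t + t) / d.+1%:R + e.+1%:R^-1) * \sum_(i < n) D i.
  apply: (@tail_weight _ _ F (large_jump l f J)) => i.
  - rewrite /D qpot_decr -expectZ; apply: ler_expect => x.
    case: (boolP (large_jump l f J i x)) => [_|].
      rewrite mul0r expr0n mulr_ge0 //; first lra.
      by apply: pot_defect_ge0; rewrite ?nrm_gt0 //; lra.
    rewrite /large_jump -leNgt => h; rewrite mul1r.
    by apply: pot_smooth_jump => //; rewrite ?nrm_gt0 //; lra.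
  - apply: (@le_trans _ _ (3 ^+ e * Pr R (large_jump l f J i) * (2 * expR (- (l / 2))))).
      apply: wle_indicator; last exact: Pr_large_jump.
        by rewrite mulr_ge0 ?expR_ge0.
      move=> x; rewrite normrM ger0_norm ?ler0n // -[leRHS]mulr1.
      rewrite ler_wpM2l ?ler0n // /dif.
      have a0 := pot_gt0 t (nrm l f J x); have b0 := pot_gt0 t (nrm l f J (flip x [set i])).
      have a1 := pot_le1 (ltW t0) (nrm_ge1 l f J x).
      have b1 := pot_le1 (ltW t0) (nrm_ge1 l f J (flip x [set i])).
      by rewrite /F ler_norml; apply/andP; split; lra.
    have P0 : 0 <= Pr R (large_jump l f J i) by apply: expect_ge0 => x; exact: ler0n.
    have PD : t / 8 * expR (- (2 * t * (2 * l))) * Pr R (large_jump l f J i) <= D i.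
      rewrite /D qpot_decr /Pr -expectZ; apply: ler_expect => x.
      case: (boolP (large_jump l f J i x)) => [/ltW h|_]; last first.
        by rewrite mulr0; apply: pot_defect_ge0; rewrite ?nrm_gt0 //; lra.
      rewrite mulr1; apply: pot_large_jump => //; rewrite ?nrm_gt0 ?ln_nrm_le //; lra.
    apply: le_trans (ler_wpM2l (ltW t0) PD).
    rewrite [leRHS]mulrA [leLHS]mulrAC; apply: ler_wpM2r => //.
    exact: jump_constants.
  - rewrite /D qpot_decr; apply: ler_expect => x.
    apply: le_trans (defect i x); rewrite /dif /F.
    apply: (@le_trans _ _ ((pot t (nrm l f J x) - pot t (nrm l f J (flip x [set i]))) ^+ 2 / 2)).
      by have := sqr_ge0 (pot t (nrm l f J x) - pot t (nrm l f J (flip x [set i]))); nra.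
    by rewrite lerDl pot_gap_ge0.
rewrite sum_fcoef_above in h.
have -> : qpot l f (2 * t) J = expect (fun x => F x ^+ 2).
  by apply: eq_expect => x; rewrite pot2.
apply: le_trans h _; rewrite (_ : \sum_(i < n) (_ - _) = \sum_(i < n) D i); last first.
  by apply: eq_bigr => i _; congr (_ - _); apply: eq_expect => x; rewrite pot2.
apply: ler_wpM2r; first exact: sumr_ge0.
rewrite (_ : 2 * (24 * t + t) = 50 * t); last by ring.
rewrite lerD2l -[16 / l]invf_div lef_pV2 ?posrE ?ltr0n //; lra.
Qed.

Lemma expR_ge16 (R : realType) (x : R) : 4 <= x -> 16 <= expR x.
Proof.
move=> x4; rewrite (_ : x = 4%:R * (x / 4)); last by field.
rewrite expRM_natl; have h := expR_ge1Dx (x / 4).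
have -> : 16 = 2 ^+ 4 :> R by ring.
by rewrite lerXn2r ?nnegrE ?expR_ge0 //; lra.
Qed.

(** Put A = ln(q2 / q1^2) for the moments q1, q2 at t and 2 t. If 0 < A <= 8, the weight above level
    0 is q2 (1 - e^(-A)) >= q2 A / 9. If A > 8, [wle_nonneg] leaves at least 3/4 of q2 above level d
    = floor(A / 8), and the division by d + 1 in [qpot_tail] gains the factor A. *)
Lemma qpot_step (R : realType) (l t : R) n (f : cube n -> bool) J :
  1024 <= l -> l^-1 <= t -> t <= 1 / 32 ->
  (forall i, Inf R f i <= expR (- (2 * l))) ->
  (ln (qpot l f (2 * t) J) - 2 * ln (qpot l f t J)) * qpot l f (2 * t) J <=
  1000 * t * \sum_(i < n) (qpot l f (2 * t) J - qpot l f (2 * t) (i |: J)).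
Proof.
move=> l0 lt t1 fi.
have t0 : 0 < t by apply: lt_le_trans lt; rewrite invr_gt0; lra.
have l1 : 1 <= l by lra.
have t20 : 0 <= 2 * t by lra.
have tail d := qpot_tail J d l0 lt t1 fi.
set D := \sum_(i < n) _ in tail *.
have D0 : 0 <= D.
  by apply: sumr_ge0 => i _; rewrite subr_ge0 qpot_mono //; lra.
set F := fun x => pot t (nrm l f J x) in tail.
have FE : qpot l f t J = expect F by [].
have F2E : qpot l f (2 * t) J = expect (fun x => F x ^+ 2).
  by apply: eq_expect => x; rewrite pot2.
have wn d : wle F d ^+ 2 <= qpot l f t J ^+ 2 * qpot l f (2 * t) J * 9 ^+ d.
  by rewrite F2E FE; apply: wle_nonneg => x; exact: ltW (pot_gt0 _ _).
have w0 := wle0 F; rewrite -FE in w0.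
have q1p := qpot_gt0 f J (ltW t0) l1; have q2p := qpot_gt0 f J t20 l1.
have q21 := qpot_le1 l f J t20.
have q1ge := qpot_ge f J (ltW t0) l1.
set q1 := qpot l f t J in wn w0 q1p q1ge *; set q2 := qpot l f (2 * t) J in wn q2p q21 tail *.
set A := ln q2 - 2 * ln q1.
have q1E : q1 ^+ 2 = q2 * expR (- A).
  rewrite -{1}[q2]lnK ?posrE // -expRD opprB addrCA subrr addr0.
  by rewrite mulr_natl mulr2n expRD lnK ?posrE.
have tl : 1 <= t * l by rewrite -ler_pdivrMr ?mul1r //; lra.
have il : 16 / l <= 16 * t by rewrite ler_pM2l //.
have [A8|A8] := leP A 8.
  have [A0|A0] := leP A 0.
    apply: (@le_trans _ _ 0); first by rewrite mulr_le0_ge0 // ltW.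
    exact: mulr_ge0 (mulr_ge0 (ler0n R 1000) (ltW t0)) D0.
  have := tail 0%N; rewrite w0 divr1 => h.
  have e := expRN_le (ltW A0).
  have e' : (1 + A)^-1 <= 1 - A / 9 by rewrite -[leLHS]mul1r ler_pdivrMr; nra.
  have : q2 * (A / 9) <= q2 - q1 ^+ 2 by rewrite q1E; nra.
  have : (50 * t + 16 / l) * D <= 66 * t * D by rewrite ler_wpM2r //; lra.
  have : 0 <= t * D by rewrite mulr_ge0 // ltW.
  nra.
pose d := Num.truncn (A / 8).
have A80 : 0 <= A / 8 by lra.
have /andP[dA Ad] := truncn_itv A80; rewrite -/d in dA Ad.
have W : wle F d <= q2 / 4.
  rewrite -ler_sqr ?nnegrE ?wle_ge0 //; last by rewrite divr_ge0 // ltW.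
  apply: le_trans (wn d) _; rewrite q1E.
  have A24 : 4 <= A / 2 by lra.
  have e9 : 9 ^+ d <= expR (A / 2) :> R.
    apply: (@le_trans _ _ (expR (d%:R * 4))); last by rewrite ler_expR; lra.
    rewrite expRM_natl lerXn2r ?nnegrE ?expR_ge0 //.
    by have := expR_ge16 (lexx (4 : R)); lra.
  move: (9 ^+ d) e9 => N9 e9.
  have e16 : expR (- A) * expR (A / 2) <= 16^-1.
    rewrite -expRD (_ : - A + A / 2 = - (A / 2)); last by field.
    rewrite expRN lef_pV2 ?posrE ?expR_gt0 //.
    exact: expR_ge16.
  have e25 : expR (- A) * N9 <= 16^-1.
    by apply: le_trans e16; rewrite ler_wpM2l ?expR_ge0.
  have -> : (q2 / 4) ^+ 2 = q2 ^+ 2 * 16^-1 by field.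
  have -> : q2 * expR (- A) * q2 * N9 = q2 ^+ 2 * (expR (- A) * N9) by ring.
  by rewrite ler_wpM2l ?sqr_ge0.
(* This makes 1 / l at most 4 t / A, so the second term of [qpot_tail] gains a factor A too. *)
have A4 : A <= 4 * t * l.
  have h1 : ln q2 <= 0 by exact: ln_le0.
  have h2 : - (2 * t * l) <= ln q1 by rewrite -[leLHS]expRK ler_ln ?posrE ?expR_gt0.
  by rewrite /A; lra.
have := tail d => h.
have Ap : 0 < A by lra.
have dp : 50 * t / d.+1%:R <= 400 * t / A.
  rewrite ler_pdivrMr ?ltr0n // mulrAC ler_pdivlMr //.
  have : 50 * t * A <= 50 * t * (8 * d.+1%:R) by rewrite ler_pM2l; lra.
  lra.
have lA : 16 / l <= 64 * t / A.
  rewrite ler_pdivrMr; last by lra.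
  by rewrite mulrAC ler_pdivlMr //; lra.
have h3 : q2 * 3 / 4 <= 464 * t / A * D.
  apply: (@le_trans _ _ ((50 * t / d.+1%:R + 16 / l) * D)).
    by apply: le_trans h; lra.
  rewrite ler_wpM2r // (_ : 464 * t / A = 400 * t / A + 64 * t / A).
    exact: lerD.
  by rewrite -mulrDl; congr (_ / _); ring.
have : q2 * 3 / 4 * A <= 464 * t * D.
  have := ler_wpM2r (ltW Ap) h3.
  rewrite (_ : 464 * t / A * D * A = 464 * t * D) //.
  by field; rewrite gt_eqF.
have : 0 <= t * D by rewrite mulr_ge0 // ltW.
nra.
Qed.

Lemma qpot_sqr_le (R : realType) (l t : R) n (f : cube n -> bool) J :
  qpot l f t J ^+ 2 <= qpot l f (2 * t) J.
Proof.
rewrite -subr_ge0.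
have -> : qpot l f (2 * t) J - qpot l f t J ^+ 2 =
    expect (fun x => (pot t (nrm l f J x) - qpot l f t J) ^+ 2).
  rewrite (eq_expect (h := fun x => (pot (2 * t) (nrm l f J x) -
     (2 * qpot l f t J) * pot t (nrm l f J x)) + qpot l f t J ^+ 2)).
    rewrite expectD expectB expectZ expect_cst -/(qpot l f t J).
    by rewrite -/(qpot l f (2 * t) J); ring.
  by move=> x; rewrite pot2; ring.
by apply: expect_ge0 => x; exact: sqr_ge0.
Qed.

(** * The drift of the potential *)

(** The quantity H_j; the exponents 2^j / l double from 1 / l on. *)
Definition lnq (R : realType) (l : R) n (f : cube n -> bool) J (j : nat) : R :=
  - ln (qpot l f (2 ^+ j / l) J).

Lemma lvl_gt0 (R : realType) (l : R) j : 1 <= l -> 0 < 2 ^+ j / l.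
Proof. by move=> l1; rewrite divr_gt0 ?exprn_gt0 //; lra. Qed.

Lemma lvlS (R : realType) (l : R) j : 2 ^+ j.+1 / l = 2 * (2 ^+ j / l).
Proof. by rewrite exprS mulrA. Qed.

Lemma lnq_ge0 (R : realType) (l : R) n (f : cube n -> bool) J j :
  1 <= l -> 0 <= lnq l f J j.
Proof.
move=> l1; have t0 := ltW (lvl_gt0 j l1).
by rewrite oppr_ge0; apply: ln_le0; exact: qpot_le1.
Qed.

Lemma lnq_le (R : realType) (l : R) n (f : cube n -> bool) J j :
  1 <= l -> lnq l f J j <= 2 ^+ j.+1.
Proof.
move=> l1; have t0 := ltW (lvl_gt0 j l1).
rewrite lerNl -[leLHS]expRK ler_ln ?posrE ?expR_gt0 ?qpot_gt0 //.
apply: le_trans (qpot_ge f J t0 l1); rewrite ler_expR exprS.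
by rewrite le_eqVlt; apply/orP; left; apply/eqP; field; lra.
Qed.

Lemma lnq_mono (R : realType) (l : R) n (f : cube n -> bool) J i j :
  1 <= l -> 2 ^+ j / l <= 2 -> lnq l f J j <= lnq l f (i |: J) j.
Proof.
move=> l1 t2; have t0 := lvl_gt0 j l1.
by rewrite lerN2 ler_ln ?posrE ?qpot_gt0 ?qpot_mono // ltW.
Qed.

Lemma lnq_ratio_ge0 (R : realType) (l : R) n (f : cube n -> bool) J j :
  1 <= l -> 0 <= 2 * lnq l f J j - lnq l f J j.+1.
Proof.
move=> l1; have t0 := ltW (lvl_gt0 j l1); have t1 := ltW (lvl_gt0 j.+1 l1).
have := qpot_sqr_le l (2 ^+ j / l) f J; rewrite -lvlS.
have q0 := qpot_gt0 f J t0 l1; have q1 := qpot_gt0 f J t1 l1.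
rewrite /lnq; move: (qpot _ _ _ _) (qpot _ _ _ _) q0 q1 => a b a0 b0.
rewrite -ler_ln ?posrE ?exprn_gt0 // lnXn // -mulr_natl.
by lra.
Qed.

Lemma ln_sub_ge (R : realType) (a b : R) :
  0 < a -> 0 < b -> (a - b) / a <= ln a - ln b.
Proof.
move=> a0 b0; have ba : 0 < b / a by rewrite divr_gt0.
have : ln (1 + (b / a - 1)) <= b / a - 1 by apply: le_ln1Dx; lra.
rewrite addrC subrK ln_div ?posrE // mulrBl divff ?gt_eqF //; lra.
Qed.

(** Divide [qpot_step] at t = 2^j / l by q_(j+1); a relative decrease of q_(j+1) is at most the
    increase of - ln q_(j+1). *)
Lemma lnq_drift (R : realType) (l : R) n (f : cube n -> bool) J j :
  1024 <= l -> 2 ^+ j / l <= 1 / 32 ->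
  (forall i, Inf R f i <= expR (- (2 * l))) ->
  l / 1000 * ((2 * lnq l f J j - lnq l f J j.+1) / 2 ^+ j) <=
  \sum_(i < n) (lnq l f (i |: J) j.+1 - lnq l f J j.+1).
Proof.
move=> l0 t1 fi; have l1 : 1 <= l by lra.
have t0 := lvl_gt0 j l1.
have lt : l^-1 <= 2 ^+ j / l.
  by rewrite -[leLHS]mul1r ler_pM2r ?invr_gt0 ?exprn_ege1 //; lra.
have := qpot_step J l0 lt t1 fi; rewrite -lvlS -/(lnq l f J j).
have qp i : 0 < qpot l f (2 ^+ j.+1 / l) i by rewrite qpot_gt0 // ltW // lvl_gt0.
set q := qpot l f _ J; set A := (ln q - _) => st.
have -> : 2 * lnq l f J j - lnq l f J j.+1 = A by rewrite /A /lnq -/q; ring.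
apply: (@le_trans _ _ (\sum_(i < n) (q - qpot l f (2 ^+ j.+1 / l) (i |: J)) / q)).
  rewrite -mulr_suml ler_pdivlMr; last exact: qp.
  have p0 : 0 < 2 ^+ j :> R by rewrite exprn_gt0.
  have k0 : 0 < 1000 * (2 ^+ j / l) by apply: mulr_gt0 t0; rewrite ltr0n.
  rewrite -(ler_pM2l k0); apply: le_trans st.
  rewrite le_eqVlt; apply/orP; left; apply/eqP.
  have ln0 : l != 0 by apply/lt0r_neq0; lra.
  have pn0 := lt0r_neq0 p0; move: (2 ^+ j) pn0 => p pn0; field.
  by rewrite ln0 pn0.
apply: ler_sum => i _; rewrite /lnq -/q; set q' := qpot _ _ _ _.
have q'p : 0 < q' := qp _.
rewrite opprK [leRHS]addrC; exact: ln_sub_ge (qp J) q'p.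
Qed.

(** While H_0 < 1/2, the mean q_0 of (1 + e^l M_J)^(-1/l) is at least e^(-1/2), yet where M_J >= mu
    / 2 the variable is at most e^(-9/10). This forces a variance q_1 - q_0^2 of order mu, and 2 H_0
    - H_1 is at least that variance. *)
Lemma lnq_ratio0 (R : realType) (l : R) n (f : cube n -> bool) J :
  1024 <= l -> let mu : R := expect (fun x => (f x)%:R) in
  2 * expR (- (l / 10)) <= mu -> lnq l f J 0 < 1 / 2 ->
  mu / 2000 <= 2 * lnq l f J 0 - lnq l f J 1.
Proof.
move=> l0 mu mul h0; have l1 : 1 <= l by lra.
have m0 : 0 < mu by apply: lt_le_trans mul; rewrite mulr_gt0 ?expR_gt0.
rewrite /lnq (lvlS l 0) expr0; set t := 1 / l.
have t0 : 0 < t by rewrite divr_gt0 //; lra.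
have q0p := qpot_gt0 f J (ltW t0) l1.
have t20 : 0 <= 2 * t by rewrite mulr_ge0 // ltW.
have q1p := qpot_gt0 f J t20 l1.
have q11 := qpot_le1 l f J t20.
have q0h : expR (- (1 / 2)) <= qpot l f t J.
  rewrite -[leRHS]lnK ?posrE // ler_expR; move: h0.
  by rewrite /lnq expr0 -/t; lra.
set q0 := qpot l f t J in q0p q0h *; set q1 := qpot l f (2 * t) J in q1p q11 *.
have step1 : q1 - q0 ^+ 2 <= 2 * - ln q0 - - ln q1.
  have q0p2 : 0 < q0 ^+ 2 by rewrite exprn_gt0.
  rewrite opprK mulrN [leRHS]addrC mulr_natl -lnXn //.
  apply: le_trans (ln_sub_ge q1p q0p2).
  rewrite ler_pdivlMr // ler_piMr // subr_ge0; exact: qpot_sqr_le.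
apply: le_trans step1.
have -> : q1 - q0 ^+ 2 = expect (fun x => (pot t (nrm l f J x) - q0) ^+ 2).
  rewrite (eq_expect (h := fun x => (pot (2 * t) (nrm l f J x) -
     (2 * q0) * pot t (nrm l f J x)) + q0 ^+ 2)).
    rewrite expectD expectB expectZ expect_cst -/(qpot l f t J).
    by rewrite -/(qpot l f (2 * t) J) -/q0 -/q1; ring.
  by move=> x; rewrite pot2; ring.
have gap : 1 / 25 <= expR (- (1 / 2)) - expR (- (9 / 10)) :> R.
  have -> : - (1 / 2) = - (9 / 10) + 4 / 10 :> R by field.
  rewrite expRD; have := expR_ge1Dx (4 / 10 : R); have := expR_ge1Dx (- (9 / 10) : R).
  nra.
(* [mavg] has mean mu and is at most 1. *)
have markov : mu / 2 <= expect (fun x => (mu / 2 <= mavg R f J x)%R%:R).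
  have : mu <= expect (fun x => (mu / 2 <= mavg R f J x)%R%:R) + mu / 2.
    rewrite -[X in _ + X](@expect_cst R n) -expectD {1}/mu -(expect_mavg R f J).
    apply: ler_expect => x; have := mavg_le1 R f J x.
    by case: (leP (mu / 2) (mavg R f J x)) => h /=; lra.
  lra.
apply: (@le_trans _ _ (1 / 1000 * expect (fun x => (mu / 2 <= mavg R f J x)%R%:R))).
  lra.
rewrite -expectZ; apply: ler_expect => x.
case: (leP (mu / 2) (mavg R f J x)) => mx; last by rewrite mulr0 sqr_ge0.
have px : pot t (nrm l f J x) <= expR (- (9 / 10)).
  rewrite /pot ler_expR lerN2 /t mul1r [leRHS]mulrC ler_pdivlMr; last by lra.
  apply: (@le_trans _ _ (ln (expR (- (l / 10)) * expR l))).
    by rewrite -expRD expRK; lra.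
  rewrite ler_ln ?posrE ?mulr_gt0 ?expR_gt0 ?nrm_gt0 // /nrm.
  have := expR_gt0 l; nra.
have g : 1 / 25 <= q0 - pot t (nrm l f J x) by lra.
have g0 : 0 <= 1 / 25 :> R by rewrite divr_ge0.
have := ler_pM g0 g0 g g; rewrite /= mulr1 -sqrrN opprB expr2; lra.
Qed.

(** The sum makes the drifts telescope; H_1 / mu supplies drift while H_0 is small and the
    telescoped sum may be negligible. *)
Definition phi (R : realType) (l mu : R) n (f : cube n -> bool) (m : nat)
    (J : {set 'I_n}) : R :=
  \sum_(j < m) lnq l f J j.+1 + lnq l f J 1 / mu.

Lemma phi_ge0 (R : realType) (l mu : R) n (f : cube n -> bool) m J :
  1 <= l -> 0 < mu -> 0 <= phi l mu f m J.
Proof.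
move=> l1 m0; rewrite addr_ge0 ?divr_ge0 ?lnq_ge0 ?(ltW m0) //.
by apply: sumr_ge0 => j _; exact: lnq_ge0.
Qed.

Lemma phi_le (R : realType) (l mu : R) n (f : cube n -> bool) m J :
  1 <= l -> 0 < mu -> phi l mu f m J <= 4 * 2 ^+ m + 4 / mu.
Proof.
move=> l1 m0; apply: lerD; last first.
  rewrite ler_pM2r ?invr_gt0 //; apply: le_trans (lnq_le f J 1 l1) _.
  by rewrite !exprS expr0; lra.
apply: (@le_trans _ _ (\sum_(j < m) 2 ^+ j.+2)).
  by apply: ler_sum => j _; exact: lnq_le.
elim: m => [|m IH]; first by rewrite big_ord0 mulr_ge0 ?exprn_ge0.
rewrite big_ord_recr /= !exprS; have := IH.
have : 0 <= 2 ^+ m :> R by rewrite exprn_ge0.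
move: (2 ^+ m) => p; lra.
Qed.

Lemma lvl_le (R : realType) (l : R) j m :
  1 <= l -> (j <= m)%N -> 2 ^+ j / l <= 2 ^+ m / l.
Proof.
move=> l1 jm; rewrite ler_pM2r ?invr_gt0; last by lra.
by rewrite ler_weXn2l ?ler1n.
Qed.

Lemma phi_mono (R : realType) (l mu : R) n (f : cube n -> bool) m J i :
  1024 <= l -> 0 < mu -> 2 ^+ m / l <= 1 / 16 ->
  phi l mu f m J <= phi l mu f m (i |: J).
Proof.
move=> l0 m0 lm; have l1 : 1 <= l by lra.
apply: lerD; last first.
  apply: ler_wpM2r; first by rewrite invr_ge0 ltW.
  by apply: lnq_mono => //; rewrite expr1 ler_pdivrMr; lra.
apply: ler_sum => j _; apply: lnq_mono => //.
by apply: le_trans (lvl_le l1 (ltn_ord j)) _; lra.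
Qed.

Lemma phi_drift (R : realType) (l : R) n (f : cube n -> bool) m J :
  1024 <= l -> let mu : R := expect (fun x => (f x)%:R) in
  2 * expR (- (l / 10)) <= mu -> 2 ^+ m / l <= 1 / 16 ->
  (forall i, Inf R f i <= expR (- (2 * l))) ->
  lnq l f J m < 2 ^+ m / 4 ->
  l / 1000 / 2000 <= \sum_(i < n) (phi l mu f m (i |: J) - phi l mu f m J).
Proof.
move=> l0 mu mul lm fi bad; have l1 : 1 <= l by lra.
have m0 : 0 < mu by apply: lt_le_trans mul; rewrite mulr_gt0 ?expR_gt0.
pose A j := (2 * lnq l f J j - lnq l f J j.+1) / 2 ^+ j.
have A0 j : 0 <= A j by rewrite divr_ge0 ?lnq_ratio_ge0 ?exprn_ge0.
have -> : \sum_(i < n) (phi l mu f m (i |: J) - phi l mu f m J) =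
    \sum_(j < m) \sum_(i < n) (lnq l f (i |: J) j.+1 - lnq l f J j.+1) +
    (\sum_(i < n) (lnq l f (i |: J) 1 - lnq l f J 1)) / mu.
  rewrite exchange_big /= mulr_suml -big_split /=; apply: eq_bigr => i _.
  by rewrite /phi sumrB mulrBl opprD addrACA.
have half (j : nat) : (j < m)%N -> 2 ^+ j / l <= 1 / 32.
  by move=> jm; have := lvl_le l1 jm; rewrite lvlS; lra.
have d1 : l / 1000 * \sum_(j < m) A j <=
    \sum_(j < m) \sum_(i < n) (lnq l f (i |: J) j.+1 - lnq l f J j.+1).
  by rewrite mulr_sumr; apply: ler_sum => j _; apply: lnq_drift => //; exact: half.
have d2 : l / 1000 * A 0%N / mu <=
    (\sum_(i < n) (lnq l f (i |: J) 1 - lnq l f J 1)) / mu.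
  rewrite ler_pM2r ?invr_gt0 //; apply: lnq_drift => //.
  by rewrite expr0 ler_pdivrMr; lra.
apply: le_trans (lerD d1 d2).
have tel : \sum_(j < m) A j = 2 * (lnq l f J 0 - lnq l f J m / 2 ^+ m).
  rewrite -(big_mkord xpredT A).
  have -> : lnq l f J 0 = lnq l f J 0 / 2 ^+ 0 by rewrite expr0 divr1.
  rewrite -opprB -(telescope_sumr (fun j => lnq l f J j / 2 ^+ j)) //.
  rewrite -sumrN mulr_sumr; apply: eq_bigr => j _; rewrite /A exprS.
  have : 0 < 2 ^+ j :> R by rewrite exprn_gt0.
  by move: (2 ^+ j) => p p0; field; rewrite gt_eqF.
have lp : 0 < l / 1000 by lra.
have A0mu : 0 <= A 0%N / mu by rewrite divr_ge0 // ltW.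
rewrite -[l / 1000 * A 0%N / mu]mulrA -mulrDr ler_pM2l //.
(* If H_0 >= 1/2, telescoping gives at least 2 (1/2 - 1/4) = 1/2; otherwise [lnq_ratio0] makes A_0 /
   mu at least 1/2000. *)
have [h|h] := leP (1 / 2) (lnq l f J 0).
  have : lnq l f J m / 2 ^+ m <= 1 / 4.
    rewrite ler_pdivrMr ?exprn_gt0 //; move: bad.
    by move: (2 ^+ m) => p; lra.
  move: tel; move: (lnq l f J m / 2 ^+ m) => z; lra.
have := lnq_ratio0 l0 mul h; rewrite -/mu => h'.
have : 2000^-1 <= A 0%N / mu.
  by rewrite ler_pdivlMr // /A expr0 divr1; lra.
have : 0 <= \sum_(j < m) A j by apply: sumr_ge0.
lra.
Qed.

(** * Random orders and random blocks *)

(** The first [k] coordinates in the order [s]; for uniform [s] this is a uniform k-set. *)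
Definition pref n (s : {perm 'I_n}) (k : nat) : {set 'I_n} :=
  s @: [set i : 'I_n | (i < k)%N].

Lemma mem_pref n (s : {perm 'I_n}) k (i : 'I_n) : (s i \in pref s k) = (i < k)%N.
Proof. by rewrite mem_imset ?inE //; exact: perm_inj. Qed.

Lemma pref0 n (s : {perm 'I_n}) : pref s 0 = set0.
Proof. by rewrite /pref (_ : [set i | _] = set0) ?imset0 //; apply/setP => i; rewrite !inE. Qed.

Lemma prefS n (s : {perm 'I_n}) (k : 'I_n) : pref s k.+1 = s k |: pref s k.
Proof.
rewrite /pref (_ : [set i : 'I_n | (i < k.+1)%N] = k |: [set i : 'I_n | (i < k)%N]).
  by rewrite imsetU1.
by apply/setP => i; rewrite !inE ltnS leq_eqVlt.
Qed.

(** Given the first k coordinates, the next one is uniform among the other n - k: precomposing with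
    the transposition of k and some j >= k permutes the orders and keeps the prefix. *)
Lemma sum_perm_pref (R : realType) n (k : 'I_n) (h : {set 'I_n} -> 'I_n -> R) :
  \sum_(s : {perm 'I_n}) \sum_(i | i \notin pref s k) h (pref s k) i =
  (n - k)%:R * \sum_(s : {perm 'I_n}) h (pref s k) (s k).
Proof.
transitivity (\sum_(s : {perm 'I_n}) \sum_(j : 'I_n | (k <= j)%N) h (pref s k) (s j)).
  apply: eq_bigr => s _; rewrite (reindex_inj (@perm_inj _ s)) /=.
  by apply: eq_bigl => j; rewrite mem_pref -leqNgt.
rewrite exchange_big /=.
rewrite (eq_bigr (fun=> \sum_(s : {perm 'I_n}) h (pref s k) (s k))) => [|j kj].
  rewrite sumr_const -[LHS]mulr_natl; congr (_%:R * _).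
  have -> : (n - k)%N = #|~: [set i : 'I_n | (i < k)%N]|.
    rewrite cardsCs setCK card_ord; congr (_ - _)%N.
    rewrite -[LHS]card_ord -!sum1_card (big_ord_widen n (fun=> 1%N)) 1?ltnW //.
    by apply: eq_bigl => i; rewrite !inE.
  by apply: eq_card => i; rewrite !inE -leqNgt.
rewrite (reindex_inj (mulgI (tperm k j))) /=; apply: eq_bigr => s _.
have -> : pref (tperm k j * s)%g k = pref s k.
  rewrite /pref (eq_imset (g := s \o tperm k j)) => [|i]; last by rewrite permM.
  rewrite imset_comp (_ : tperm k j @: _ = [set i : 'I_n | (i < k)%N]) //.
  apply/setP => i.
  rewrite -{1}(tpermK k j i) mem_imset ?inE; last exact: perm_inj.
  by case: tpermP => [->|->|] //; rewrite ltnn ltnNge kj.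
by rewrite permM tpermR.
Qed.

(** An order bad at time k is bad at all earlier times, so each of the k steps raises [F] by at
    least c / n times the fraction of such orders, on average; the total rise is at most B. *)
Lemma pref_drift (R : realType) n (F : {set 'I_n} -> R) (bad : {set 'I_n} -> bool)
    (c B : R) (k : nat) :
  (forall J i, F J <= F (i |: J)) -> (forall J, 0 <= F J <= B) -> 0 <= c ->
  (forall J, bad J -> c <= \sum_(i < n) (F (i |: J) - F J)) ->
  (forall J i, bad (i |: J) -> bad J) -> (k <= n)%N ->
  c * k%:R * \sum_(s : {perm 'I_n}) (bad (pref s k))%:R <=
  n%:R * B * #|{perm 'I_n}|%:R.
Proof.
move=> Fmono FB c0 drift badW kn.
set b := \sum_s _.
have badS s j : (j <= k)%N -> bad (pref s k) -> bad (pref s j).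
  move=> jk; rewrite -{1}(subnKC jk); move: (k - j)%N (subnKC jk) => d e.
  have: (j + d <= n)%N by rewrite e.
  elim: d {e} => [|d IH]; rewrite ?addn0 // addnS => jd.
  rewrite (prefS s (Ordinal jd)) => /badW; apply: IH; exact: ltnW.
have step (j : nat) : (j <= k)%N -> c * j%:R * b <=
    n%:R * \sum_(s : {perm 'I_n}) (F (pref s j) - F set0).
  elim: j => [_|j IH jk].
    rewrite mulr0 mul0r big1 ?mulr0 // => s _.
    by rewrite pref0 subrr.
  have jn : (j < n)%N := leq_trans jk kn.
  pose o := Ordinal jn.
  have e := sum_perm_pref o (fun J i => F (i |: J) - F J).
  have E0 : 0 <= \sum_(s : {perm 'I_n}) (F (s o |: pref s o) - F (pref s o)).
    by apply: sumr_ge0 => s _; rewrite subr_ge0.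
  have : c * b <= n%:R *
      \sum_(s : {perm 'I_n}) (F (s o |: pref s o) - F (pref s o)).
    apply: (@le_trans _ _ ((n - o)%:R *
      \sum_(s : {perm 'I_n}) (F (s o |: pref s o) - F (pref s o)))).
      rewrite -e mulr_sumr; apply: ler_sum => s _.
      have -> : \sum_(i | i \notin pref s o) (F (i |: pref s o) - F (pref s o)) =
          \sum_(i < n) (F (i |: pref s o) - F (pref s o)).
        rewrite big_mkcond; apply: eq_bigr => i _; case: ifP => // /negbFE ip.
        by rewrite (setUidPr _) ?sub1set // subrr.
      case: (boolP (bad (pref s k))) => [bk|_].
        by rewrite mulr1; apply: drift; apply: badS bk; exact: ltnW.
      by rewrite mulr0; apply: sumr_ge0 => i _; rewrite subr_ge0.
    by rewrite ler_wpM2r // ler_nat leq_subr.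
  have := IH (ltnW jk).
  rewrite (_ : \sum_s (F (pref s j.+1) - F set0) =
     \sum_(s : {perm 'I_n}) (F (pref s j) - F set0) +
     \sum_(s : {perm 'I_n}) (F (s o |: pref s o) - F (pref s o))); last first.
    rewrite -big_split /=; apply: eq_bigr => s _.
    by rewrite (prefS s o) /=; ring.
  rewrite -[j.+1]addn1 natrD mulrDr mulr1 mulrDl mulrDr => h1 h2; exact: lerD.
apply: le_trans (step k (leqnn k)) _.
rewrite -mulrA ler_wpM2l // mulr_natr -sumr_const; apply: ler_sum => s _.
have /andP[_ h] := FB (pref s k); have /andP[h0 _] := FB set0; lra.
Qed.

Definition nonconst n (f : cube n -> bool) (x : cube n) (J : {set 'I_n}) : bool :=
  [exists T : {set 'I_n}, (T \subset J) && (f x != f (flip x T))].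

(** A sensitive set is picked in each nonconstant block. These sets are nonempty and disjoint, hence
    distinct, so their number survives passing to a set of sets. *)
Lemma bs_disjoint n (f : cube n -> bool) (x : cube n) (m : nat)
    (B : 'I_m -> {set 'I_n}) :
  (forall i j, i != j -> [disjoint B i & B j]) ->
  (\sum_(j < m) nonconst f x (B j) <= bs f x)%N.
Proof.
move=> dB; pose T j := odflt set0
  [pick T : {set 'I_n} | (T \subset B j) && (f x != f (flip x T))].
have TP j : nonconst f x (B j) -> (T j \subset B j) && (f x != f (flip x (T j))).
  move=> /existsP[U hU]; rewrite /T; case: pickP => [//|/(_ U)].
  by rewrite hU.
pose A := [set j | nonconst f x (B j)].
pose P := T @: A.
have flip0 : flip x set0 = x by apply/ffunP => j; rewrite ffunE inE addbF.
have T0 j : j \in A -> T j != set0.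
  rewrite inE => /TP /andP[_]; apply: contraNneq => ->.
  by rewrite flip0.
have dT i j : i \in A -> j \in A -> i != j -> [disjoint T i & T j].
  rewrite !inE => /TP /andP[ti _] /TP /andP[tj _] ij.
  exact: disjointW ti tj (dB _ _ ij).
have Tinj : {in A &, injective T}.
  move=> i j iA jA Tij; apply/eqP/negPn/negP => ij.
  have := dT _ _ iA jA ij; rewrite -Tij -setI_eq0 setIid.
  by rewrite (negPf (T0 _ iA)).
have -> : (\sum_(j < m) nonconst f x (B j))%N = #|P|.
  rewrite card_in_imset // -sum1_card [RHS]big_mkcond /=.
  by apply: eq_bigr => j _; rewrite inE; case: nonconst.
rewrite /bs; apply: (leq_bigmax_cond P); apply/andP; split.
  apply/trivIsetP => U V /imsetP[i iA ->] /imsetP[j jA ->] TT.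
  by apply: dT => //; apply: contraNneq TT => ->.
apply/forallP => U; apply/implyP => /imsetP[j]; rewrite inE => /TP /andP[_ h] ->.
exact: h.
Qed.

(** The cyclic shift by j k works; the block fits below n, so nothing wraps around. *)
Lemma perm_block n (k j : nat) : (j * k + k <= n)%N ->
  exists r : {perm 'I_n},
    pref r k = [set i : 'I_n | (j * k <= i < j * k + k)%N].
Proof.
case: n => [|n] jk.
  by exists 1%g; apply/setP => -[].
have jk' : (j * k < n.+1)%N || (k == 0%N).
  by case: k jk => [|k] jk; rewrite ?orbT // (leq_trans _ jk) // addnS ltnS leq_addr.
exists (perm (@addrI 'I_n.+1 (inord (j * k)))); apply/setP => y.
have rE (i : 'I_n.+1) : (i < k)%N ->
    val (perm (@addrI 'I_n.+1 (inord (j * k))) i) = (j * k + i)%N.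
  move=> ik; rewrite permE /= inordK; last first.
    by move: jk'; case: eqP => [k0|]; rewrite ?orbF // k0 in ik *.
  by rewrite modn_small // (leq_trans _ jk) // ltn_add2l.
apply/imsetP/idP => [[i]|].
  rewrite !inE => ik ->; rewrite rE // leq_addr ltn_add2l /=; exact: ik.
rewrite inE => /andP[h1 h2].
have yk : (y - j * k < k)%N by rewrite ltn_subLR.
have yn : (y - j * k < n.+1)%N by rewrite (leq_ltn_trans (leq_subr _ _)).
exists (inord (y - j * k)); first by rewrite inE inordK.
by apply: val_inj; rewrite rE inordK // subnKC.
Qed.

(** Cut the positions into m consecutive blocks of length k. A random order sends each block to a
    set distributed like the prefix, and the images are disjoint, so at most bs of them are
    nonconstant. *)
Lemma bs_random_block (R : realType) n (f : cube n -> bool) (x : cube n) (m k : nat) :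
  (m * k <= n)%N ->
  m%:R * \sum_(s : {perm 'I_n}) (nonconst f x (pref s k))%:R <=
  (bs f x)%:R * #|{perm 'I_n}|%:R :> R.
Proof.
move=> mk; pose B (j : nat) := [set i : 'I_n | (j * k <= i < j * k + k)%N].
have E (j : 'I_m) : \sum_(s : {perm 'I_n}) (nonconst f x (s @: B j))%:R =
    \sum_(s : {perm 'I_n}) (nonconst f x (pref s k))%:R :> R.
  have [|r rB] := @perm_block n k j.
    by rewrite -mulSnr (leq_trans _ mk) // leq_mul2r ltn_ord orbT.
  rewrite [RHS](reindex_inj (mulgI r)) /=; apply: eq_bigr => s _.
  rewrite -[B j]rB /pref -imset_comp; congr ((nonconst _ _ _)%:R).
  by apply: eq_imset => i /=; rewrite permM.
have -> : m%:R * \sum_(s : {perm 'I_n}) (nonconst f x (pref s k))%:R =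
    \sum_(j < m) \sum_(s : {perm 'I_n}) (nonconst f x (s @: B j))%:R :> R.
  by rewrite (eq_bigr _ (fun j _ => E j)) sumr_const card_ord mulr_natl.
rewrite exchange_big /= mulr_natr -sumr_const; apply: ler_sum => s _.
rewrite -natr_sum ler_nat; apply: bs_disjoint => i j ij.
rewrite -setI_eq0 -imsetI; last by move=> ? ? _ _; exact: perm_inj.
rewrite (_ : B i :&: B j = set0) ?imset0 //; apply/setP => y; rewrite !inE.
apply/negP => /andP[/andP[a1 a2] /andP[b1 b2]].
have key (p q : nat) : (p < q)%N -> (q * k <= y)%N -> (y < p * k + k)%N -> False.
  move=> pq h1 h2; have := leq_trans h2 (leq_trans _ h1).
  by rewrite -mulSnr => /(_ (leq_mul pq (leqnn k))); rewrite ltnn.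
have [lt|gt|e] := ltngtP i j; [exact: key lt b1 a2|exact: key gt a1 b2|].
by move/eqP: ij; apply; exact: val_inj.
Qed.

(** * The tail of the block sensitivity *)

(** Where [f] vanishes on the whole subcube the base is 1, and so is its power. *)
Lemma Pr_const_le (R : realType) (l t : R) n (f : cube n -> bool) J :
  Pr R (fun x => ~~ nonconst f x J && ~~ f x) <= qpot l f t J.
Proof.
apply: ler_expect => x; case: andP => [[c fx]|_]; last exact: ltW (pot_gt0 _ _).
have -> : nrm l f J x = 1; last by rewrite /pot ln1 mulr0 oppr0 expR0.
rewrite /nrm (_ : mavg R f J x = 0) ?mul0r ?addr0 //.
rewrite -[RHS](@expect_cst R n); apply: eq_expect => z.
suff /negPf -> : ~~ f (flip x [set j in J | z j]) by [].
rewrite -(_ : f x = f (flip x [set j in J | z j])) //.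
apply/eqP/negPn/negP => h; move/negP: c; apply; apply/existsP.
exists [set j in J | z j]; rewrite h andbT.
by apply/fintype.subsetP => j; rewrite inE => /andP[].
Qed.

Lemma nonconst_negb n (f : cube n -> bool) x J :
  nonconst (fun y => ~~ f y) x J = nonconst f x J.
Proof. by apply: eq_existsb => T; rewrite (inj_eq negb_inj). Qed.

Lemma Inf_negb (R : realType) n (f : cube n -> bool) i :
  Inf R (fun x => ~~ f x) i = Inf R f i.
Proof.
rewrite !Inf_dif; apply: eq_expect => x; rewrite /dif.
by case: (f x); case: (f _) => /=; rewrite ?mulr0n ?mulr1n; field.
Qed.

Lemma expect_negb (R : realType) n (f : cube n -> bool) :
  expect (fun x => (~~ f x)%:R) = 1 - expect (fun x => (f x)%:R) :> R.
Proof.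
rewrite -[X in X - _](@expect_cst R n) -expectB; apply: eq_expect => x.
by case: (f x); rewrite /= ?subrr ?subr0.
Qed.

Lemma card_perm_gt0 (R : realType) n : 0 < #|{perm 'I_n}|%:R :> R.
Proof. by rewrite ltr0n; apply/card_gt0P; exists 1%g. Qed.

(** [pref_drift] for [phi], badness being H_m < 2^m / 4; k is large enough to leave a quarter of the
    orders. *)
Lemma bad_orders (R : realType) (l : R) n (f : cube n -> bool) (m k : nat) :
  1024 <= l -> let mu : R := expect (fun x => (f x)%:R) in
  2 * expR (- (l / 10)) <= mu -> 2 ^+ m / l <= 1 / 16 ->
  (forall i, Inf R f i <= expR (- (2 * l))) ->
  (0 < k)%N -> (k <= n)%N ->
  4 * (n%:R * (4 * 2 ^+ m + 4 / mu)) <= l / 1000 / 2000 * k%:R ->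
  \sum_(s : {perm 'I_n}) (lnq l f (pref s k) m < 2 ^+ m / 4)%R%:R <=
  #|{perm 'I_n}|%:R / 4 :> R.
Proof.
move=> l0 mu mul lm fi k0 kn big; have l1 : 1 <= l by lra.
have m0 : 0 < mu by apply: lt_le_trans mul; rewrite mulr_gt0 ?expR_gt0.
have c0 : 0 < l / 1000 / 2000.
  by apply: divr_gt0; [apply: divr_gt0; [lra|rewrite ltr0n]|rewrite ltr0n].
have := @pref_drift R n (phi l mu f m) (fun J => lnq l f J m < 2 ^+ m / 4)
  (l / 1000 / 2000) (4 * 2 ^+ m + 4 / mu) k.
set c := l / 1000 / 2000 in c0 big *; set B := 4 * 2 ^+ m + 4 / mu in big *.
set b := \sum_s _; set N := #|_|%:R => /(_ _ _ (ltW c0) _ _ kn) h.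
have {}h : c * k%:R * b <= n%:R * B * N.
  apply: h.
  - by move=> J i; exact: phi_mono.
  - by move=> J; rewrite phi_ge0 ?phi_le.
  - by move=> J; exact: phi_drift.
  - move=> J i; apply: le_lt_trans; apply: lnq_mono => //.
    by apply: le_trans lm _; lra.
have N0 : 0 < N := card_perm_gt0 R n.
have ck : 0 < c * k%:R by rewrite mulr_gt0 ?ltr0n.
have h2 : 4 * (n%:R * B) * N <= c * k%:R * N by rewrite ler_pM2r.
rewrite -(ler_pM2l ck) mulrA ler_pdivlMr // [leLHS]mulrC.
by apply: le_trans h2; rewrite -mulrA ler_pM2l.
Qed.

(** Double counting of points and orders. Both [f] and its negation are treated, their means being
    at least mu (1 - mu). *)
Lemma Pr_bs_small (R : realType) (l K : R) n (f : cube n -> bool) (m k M : nat) :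
  1024 <= l -> let mu : R := expect (fun x => (f x)%:R) in
  2 * expR (- (l / 10)) <= mu * (1 - mu) -> 2 ^+ m / l <= 1 / 16 ->
  (forall i, Inf R f i <= expR (- (2 * l))) ->
  (0 < k)%N -> (k <= n)%N -> (M * k <= n)%N -> 4 * K <= M%:R ->
  4 * (n%:R * (4 * 2 ^+ m + 4 / (mu * (1 - mu)))) <= l / 1000 / 2000 * k%:R ->
  Pr R (fun x => (bs f x)%:R < K) <= 8 * expR (- (2 ^+ m / 4)).
Proof.
move=> l0 mu mul lm fi k0 kn Mk KM big; have l1 : 1 <= l by lra.
have v0 : 0 < mu * (1 - mu) by apply: lt_le_trans mul; rewrite mulr_gt0 ?expR_gt0.
have mu0 : 0 <= mu by apply: expect_ge0 => x; exact: ler0n.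
have mu1 : 0 <= 1 - mu.
  rewrite /mu -expect_negb; apply: expect_ge0 => x; exact: ler0n.
have mup : 0 < mu by rewrite lt0r mu0 andbT; apply: contraTneq v0 => ->; rewrite mul0r ltxx.
have mup' : 0 < 1 - mu by rewrite lt0r mu1 andbT; apply: contraTneq v0 => ->; rewrite mulr0 ltxx.
have vmu : mu * (1 - mu) <= mu by nra.
have vmu' : mu * (1 - mu) <= 1 - mu by nra.
have big' (w : R) : mu * (1 - mu) <= w ->
    4 * (n%:R * (4 * 2 ^+ m + 4 / w)) <= l / 1000 / 2000 * k%:R.
  move=> vw; apply: le_trans big; rewrite ler_pM2l //; apply: ler_wpM2l => //.
  by rewrite lerD2l ler_pM2l // lef_pV2 ?posrE //; apply: lt_le_trans vw.
pose g := fun x => ~~ f x.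
have gE : expect (fun x => (g x)%:R) = 1 - mu by rewrite expect_negb.
have bf := bad_orders l0 (le_trans mul vmu) lm fi k0 kn (big' _ vmu).
have bg : \sum_(s : {perm 'I_n}) (lnq l g (pref s k) m < 2 ^+ m / 4)%R%:R <=
    #|{perm 'I_n}|%:R / 4 :> R.
  apply: bad_orders => //; rewrite ?gE; [exact: le_trans mul vmu'| |exact: big'].
  by move=> i; rewrite Inf_negb.
set N := #|_|%:R in bf bg *; have N0 : 0 < N := card_perm_gt0 R n.
pose badf s := lnq l f (pref s k) m < 2 ^+ m / 4.
pose badg s := lnq l g (pref s k) m < 2 ^+ m / 4.
pose good s := ~~ badf s && ~~ badg s.
(* At most a quarter of the orders is bad for [f], a quarter bad for its negation, and, as bs < K <=
   M / 4, a quarter gives a nonconstant subcube at [x]; a quarter remains. *)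
have few x : (bs f x)%:R < K ->
    1 <= 4 / N * \sum_(s : {perm 'I_n}) (good s && ~~ nonconst f x (pref s k))%:R.
  move=> bK; have M0 : 0 < M%:R :> R.
    apply: lt_le_trans KM; rewrite mulr_gt0 //.
    exact: le_lt_trans (ler0n R _) bK.
  have nc : \sum_(s : {perm 'I_n}) (nonconst f x (pref s k))%:R <= N / 4.
    rewrite -(ler_pM2l M0); apply: le_trans (bs_random_block R f x Mk) _.
    rewrite -/N mulrCA mulrC ler_pM2l //.
    by rewrite ler_pdivlMr // mulrC; apply: le_trans KM; rewrite ler_pM2l // ltW.
  have cover : N <= \sum_(s : {perm 'I_n}) (badf s)%:R +
      \sum_(s : {perm 'I_n}) (badg s)%:R +
      \sum_(s : {perm 'I_n}) (nonconst f x (pref s k))%:R +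
      \sum_(s : {perm 'I_n}) (good s && ~~ nonconst f x (pref s k))%:R.
    rewrite -!big_split /= /N -sum1_card natr_sum; apply: ler_sum => s _.
    rewrite -!natrD ler_nat /good.
    by case: (badf s); case: (badg s); case: nonconst.
  rewrite mulrAC ler_pdivlMr // mul1r.
  move: cover bf bg nc; rewrite -/badf -/badg; lra.
have goodE s : good s ->
    Pr R (fun x => ~~ nonconst f x (pref s k)) <= 2 * expR (- (2 ^+ m / 4)).
  move=> /andP[gf gg].
  have q (h : cube n -> bool) : ~~ (lnq l h (pref s k) m < 2 ^+ m / 4) ->
      qpot l h (2 ^+ m / l) (pref s k) <= expR (- (2 ^+ m / 4)).
    rewrite -leNgt /lnq lerNr => hh.
    by rewrite -[leLHS]lnK ?ler_expR // posrE qpot_gt0 // ltW // lvl_gt0.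
  have qf := le_trans (Pr_const_le l (2 ^+ m / l) f (pref s k)) (q f gf).
  have qg := le_trans (Pr_const_le l (2 ^+ m / l) g (pref s k)) (q g gg).
  rewrite mulr_natl mulr2n; apply: le_trans (lerD qf qg).
  rewrite /Pr -expectD; apply: ler_expect => x.
  by rewrite nonconst_negb /g -natrD ler_nat; case: nonconst; case: (f x).
apply: (@le_trans _ _ (expect (fun x => 4 / N *
   \sum_(s : {perm 'I_n}) (good s && ~~ nonconst f x (pref s k))%:R))).
  apply: ler_expect => x; case: (boolP (_ < _)) => [/few //|_].
  by rewrite mulr_ge0 ?divr_ge0 ?(ltW N0) // sumr_ge0.
rewrite expectZ expect_sum.
apply: (@le_trans _ _ (4 / N * \sum_(s : {perm 'I_n}) (2 * expR (- (2 ^+ m / 4))))).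
  apply: ler_wpM2l; first by rewrite divr_ge0 // ltW.
  apply: ler_sum => s _; have [gs|gs] := boolP (good s).
    by apply: le_trans (goodE s gs); apply: ler_expect => x /=.
  rewrite (eq_expect (h := fun=> 0)) ?expect_cst; last by move=> x.
  by rewrite mulr_ge0 ?expR_ge0.
rewrite sumr_const -[_ *+ _]mulr_natl -/N le_eqVlt; apply/orP; left; apply/eqP.
by move: (expR _) => e; field; rewrite gt_eqF.
Qed.

(** * Variance, influences and the choice of parameters *)

Lemma VarE (R : realType) n (f : cube n -> bool) :
  let mu : R := expect (fun x => (f x)%:R) in Var R f = mu * (1 - mu).
Proof.
move=> mu; rewrite /Var -/mu.
rewrite (eq_expect (h := fun x => (1 - 2 * mu) * (f x)%:R + mu ^+ 2)).
  by rewrite expectD expectZ expect_cst -/mu; ring.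
by move=> x; case: (f x); rewrite ?mulr0n ?mulr1n; ring.
Qed.

Lemma Var_le_quarter (R : realType) n (f : cube n -> bool) : Var R f <= 1 / 4.
Proof.
rewrite VarE; set mu := expect _; have := sqr_ge0 (mu - 1 / 2); nra.
Qed.

Lemma Inf_le_MaxInf (R : realType) n (f : cube n -> bool) (i : 'I_n) :
  Inf R f i <= MaxInf R f.
Proof. by rewrite /MaxInf; apply: le_bigmax. Qed.

(** The Poincare inequality: the influences sum to the Fourier weight counted with multiplicity
    |S|. *)
Lemma Var_le_MaxInf (R : realType) n (f : cube n -> bool) :
  Var R f <= n%:R * MaxInf R f.
Proof.
pose F (x : cube n) : R := (f x)%:R.
apply: (@le_trans _ _ (\sum_(i < n) Inf R f i)); last first.
  have -> : n%:R * MaxInf R f = \sum_(i < n) MaxInf R f.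
    by rewrite sumr_const card_ord mulr_natl.
  by apply: ler_sum => i _; exact: Inf_le_MaxInf.
have -> : Var R f = \sum_(S : {set 'I_n} | (0 < #|S|)%N) fcoef F S ^+ 2.
  rewrite sum_fcoef_above wle0 VarE -/F.
  rewrite (eq_expect (g := fun x => F x ^+ 2) (h := F)); first by ring.
  by move=> x; rewrite /F; case: (f x); rewrite ?expr1n ?expr0n.
under [leRHS]eq_bigr => i _ do rewrite Inf_dif Parseval.
rewrite exchange_big /= big_mkcond /=; apply: ler_sum => S _.
rewrite (sum_fcoef_dif F S); case: ifP => [S0|_]; last first.
  by rewrite mulr_ge0 ?sqr_ge0.
by rewrite ler_peMl ?sqr_ge0 // ler1n.
Qed.

Lemma bs_ge1 (R : realType) n (f : cube n -> bool) (x : cube n) :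
  0 < Var R f -> (1 <= bs f x)%N.
Proof.
move=> V0; have [T fT] : exists T, f x != f (flip x T).
  case: (pickP (fun T => f x != f (flip x T))) => [T fT|h]; first by exists T.
  suff : Var R f = 0 by move=> V; rewrite V ltxx in V0.
  have fE y : f y = f x.
    have /negbFE/eqP -> := h [set j | x j (+) y j]; congr f.
    by apply/ffunP => j; rewrite ffunE inE addbA addbb.
  rewrite VarE (eq_expect (h := fun=> (f x)%:R)) => [|y]; last by rewrite fE.
  by rewrite expect_cst; case: (f x); rewrite ?mulr0n ?mulr1n; ring.
have := @bs_disjoint n f x 1 (fun=> setT); rewrite big_ord1.
have -> : nonconst f x setT by apply/existsP; exists T; rewrite subsetT.
by apply=> i j; rewrite !ord1 eqxx.
Qed.

Lemma exists_pow2 (R : realType) (X : R) : 1 <= X ->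
  exists m : nat, X <= 2 ^+ m <= 2 * X.
Proof.
move=> X1; have ex : exists m : nat, X <= 2 ^+ m.
  exists (Num.truncn X).+1; apply: (@le_trans _ _ (Num.truncn X).+1%:R).
    by apply: ltW; have /andP[_] := truncn_itv (le_trans ler01 X1).
  by rewrite -natrX ler_nat ltnW // ltn_expl.
case: (ex_minnP ex) => m hm min; exists m; rewrite hm /=.
case: m hm min => [_ _|m hm min]; first by rewrite expr0; lra.
rewrite exprS ler_pM2l // leNgt; apply/negP => /ltW /min.
by rewrite ltnn.
Qed.

Lemma sqr_le_expR (R : realType) (l : R) : 1024 <= l -> l ^+ 2 <= expR (2 * l).
Proof.
move=> l0; rewrite mulr_natl mulr2n expRD -expr2 lerXn2r ?nnegrE ?expR_ge0 //.
  lra.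
by have := expR_ge1Dx l; lra.
Qed.

Lemma double_le_expR (R : realType) (l : R) : 1024 <= l -> 2 * l <= expR (l / 10).
Proof.
move=> l0; have -> : l / 10 = 4%:R * (l / 40) by field.
rewrite expRM_natl; set y := l / 40.
have y25 : 25 <= y by rewrite /y; lra.
have -> : l = 40 * y by rewrite /y; field.
apply: (@le_trans _ _ (y ^+ 4)); last first.
  by rewrite lerXn2r ?nnegrE ?expR_ge0 //; have := expR_ge1Dx y; lra.
have y0 : 0 <= y by lra.
have h1 : 25 * y <= y * y by rewrite ler_wpM2r.
have h2 : 25 * (y * y) <= y * (y * y) by rewrite ler_wpM2r // mulr_ge0.
rewrite -[y ^+ 4]/(y * (y * (y * y))).
have := ler_wpM2r (mulr_ge0 y0 (mulr_ge0 y0 y0)) y25.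
lra.
Qed.

Lemma Pr_compl (R : realType) n (K : R) (b : cube n -> R) :
  Pr R (fun x => K <= b x) = 1 - Pr R (fun x => b x < K).
Proof.
rewrite -[X in X - _](@expect_cst R n) -expectB; apply: eq_expect => x.
by rewrite leNgt; case: (_ < _); rewrite /= ?subrr ?subr0.
Qed.

(** Rounding the desired size [z] up gives k <= 2 z, and rounding n / k down loses at most another
    factor 2. *)
Lemma block_sizes (R : realType) (n : nat) (z : R) :
  1 <= z -> 2 * z <= n%:R ->
  exists k M : nat, [/\ (0 < k)%N, (k <= n)%N, (M * k <= n)%N, z <= k%:R &
    n%:R / (4 * z) <= M%:R].
Proof.
move=> z1 zn; have z0 : 0 <= z by lra.
have /andP[tz zt] := truncn_itv z0; set k := (Num.truncn z).+1 in zt *.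
have kz : k%:R <= 2 * z by rewrite /k -[_.+1%:R]natr1; lra.
have kn : (k <= n)%N by rewrite -(ler_nat R); exact: le_trans kz zn.
exists k, (n %/ k)%N; split => //; [exact: leq_divM|exact: ltW|].
have M1 : (1 <= n %/ k)%N by rewrite divn_gt0.
have M2 : (n < (n %/ k).+1 * k)%N by rewrite ltn_ceil.
have : (n <= 2 * (n %/ k) * k)%N.
  apply: ltnW; apply: leq_trans M2 _; rewrite leq_mul2r mul2n -addnn.
  by rewrite -addn1 leq_add2l M1 orbT.
move: (n %/ k)%N => M; rewrite -(ler_nat R) !natrM => h.
rewrite ler_pdivrMr; last by lra.
have := ler_wpM2l (ler0n R M) kz; lra.
Qed.

(** With 2^m <= 2 X and 4 / V <= X, the quantity 4 (4 2^m + 4 / V) is at most 36 X; [Q] turns the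
    drift constant into this 36. *)
Lemma pow_const (R : realType) :
  exists2 Q : R, 1 <= Q & forall a : R, Q * a / 1000 / 2000 = 36 * a.
Proof.
exists (36 * 1000 * 2000); last by move=> a; field.
by rewrite -!natrM ler1n.
Qed.

(** Let l = ln(1/tau) / 2, Y = ln ln(1/tau) and X = Y / V. Then 2^m lies in [X, 2 X], blocks have
    size about n Q X / l, and the threshold K = 2 l / (C X) is at most a quarter of the number of
    blocks. *)
Lemma bs_tail (R : realType) : exists2 C : R, 1 < C &
  forall n (f : cube n -> bool), MaxInf R f < 1 / C -> 0 < Var R f ->
    let tau := MaxInf R f in let V := Var R f in
    1 - expR (- (1 / 8) * (1 / V) * ln (ln (1 / tau))) <=
    Pr R (fun x => V * ln (1 / tau) / (C * ln (ln (1 / tau))) <= (bs f x)%:R).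
Proof.
have [Q Q1 QE] := pow_const R.
(* The bound 64 Q makes the blocks fit; the double exponential forces Y >= 8 and l >= 1024. *)
have [C eC lC] : exists2 C : R, 64 * Q < C & expR (expR 8 + 2048) <= C.
  exists (64 * Q + expR (expR 8 + 2048)); first by rewrite ltrDl expR_gt0.
  by rewrite lerDr; lra.
have C1 : 1 < C by lra.
exists C => //.
move=> n f; set tau := MaxInf R f; set V := Var R f => tauC V0; cbv zeta.
have C0 : 0 < C by lra.
have V4 : V <= 1 / 4 := Var_le_quarter R f.
have nt := Var_le_MaxInf R f; rewrite -/V -/tau in nt.
have tau0 : 0 < tau.
  rewrite ltNge; apply/negP => t0; have : n%:R * tau <= 0 by rewrite mulr_ge0_le0.
  lra.
pose l := ln (1 / tau) / 2.
have lE : ln (1 / tau) = 2 * l by rewrite /l; field.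
have tauE : tau = expR (- (2 * l)).
  by rewrite -lE expRN lnK ?posrE ?divr_gt0 // div1r invrK.
have l2 : expR 8 + 2048 <= 2 * l.
  rewrite -lE -[leLHS]expRK ler_ln ?posrE ?expR_gt0 ?divr_gt0 //.
  apply: le_trans lC _.
  by rewrite div1r -[C]invrK lef_pV2 ?posrE ?invr_gt0 // -div1r ltW.
have l0 : 1024 <= l by have := expR_gt0 (8 : R); lra.
clearbody l; rewrite lE; set Y := ln (2 * l).
have Y8 : 8 <= Y by rewrite -[leLHS]expRK ler_ln ?posrE ?expR_gt0 //; lra.
clear lC l2; clearbody Y.
set X := Y / V; have XE : Y = X * V by rewrite /X; field; rewrite gt_eqF.
have X32 : 4 * Y <= X by rewrite ler_pdivlMr //; nra.
have X0 : 0 < X by lra.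
set K := V * (2 * l) / (C * Y).
have KE : K = 2 * l / (C * X).
  by rewrite /K XE; field; rewrite !gt_eqF.
(* For K <= 1 the event is certain, as every point has block sensitivity at least 1. Otherwise C X <
   2 l, which bounds 2^m and the block size. *)
have [K1|K1] := leP K 1.
  rewrite (_ : Pr _ _ = 1); first by rewrite lerBlDr lerDl expR_ge0.
  rewrite -[RHS](@expect_cst R n); apply: eq_expect => x.
  have := bs_ge1 x V0; rewrite -(ler_nat R) => b1.
  by rewrite (le_trans K1 b1).
have XC : C * X <= 2 * l.
  have CX0 := mulr_gt0 C0 X0.
  by move: K1; rewrite KE ltr_pdivlMr // mul1r => /ltW.
have QX : 64 * (Q * X) <= 2 * l.
  by apply: le_trans XC; rewrite mulrA ler_pM2r // ltW.
have [m /andP[mX X2m]] : exists m : nat, X <= 2 ^+ m <= 2 * X.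
  by apply: exists_pow2; lra.
have XQX : X <= Q * X by rewrite ler_peMl // ltW.
have Vl : l^-1 <= V.
  rewrite -[leLHS]mul1r ler_pdivrMr; last by lra.
  have : C * Y <= 2 * l * V by rewrite XE mulrA ler_wpM2r // ltW.
  have : 64 * Y <= C * Y by rewrite ler_pM2r; lra.
  lra.
(* By the Poincare inequality n >= V / tau >= e^(2 l) / l; this is needed for a block size of at
   least 1. *)
have ln_n : l <= n%:R.
  have e1 := sqr_le_expR l0.
  have : V * expR (2 * l) <= n%:R.
    by move: nt; rewrite tauE expRN ler_pdivlMr ?expR_gt0.
  apply: le_trans; apply: (@le_trans _ _ (l^-1 * l ^+ 2)).
    by rewrite expr2 mulrA mulVf ?mul1r // gt_eqF //; lra.
  by apply: ler_pM => //; [rewrite invr_ge0; lra|exact: sqr_ge0].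
have lp : 0 < l by lra.
pose z := n%:R * (Q * X) / l.
have z1 : 1 <= z.
  rewrite ler_pdivlMr // mul1r; apply: le_trans ln_n _.
  by rewrite ler_peMr //; lra.
have zn : 2 * z <= n%:R.
  rewrite /z mulrA ler_pdivrMr // mulrCA ler_wpM2l //; lra.
have [k [M [k0 kn Mk zk zM]]] := block_sizes z1 zn.
have mul : 2 * expR (- (l / 10)) <= V.
  apply: le_trans Vl; rewrite expRN ler_pdivrMr ?expR_gt0 // mulrC.
  by rewrite ler_pdivlMr // double_le_expR.
have VmE : V = _ := VarE R f.
have tail : Pr R (fun x => (bs f x)%:R < K) <= 8 * expR (- (2 ^+ m / 4)).
  apply: (@Pr_bs_small R l K n f m k M) => //.
  - by rewrite -VmE.
  - by rewrite ler_pdivrMr //; move: X2m; move: (2 ^+ m) => p; lra.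
  - by move=> i; rewrite -tauE; exact: Inf_le_MaxInf.
  - apply: le_trans zM; rewrite KE /z.
    rewrite (_ : n%:R / _ = l / (4 * (Q * X))); last first.
      by field; rewrite !gt_eqF //; lra.
    have CX0 := mulr_gt0 C0 X0; have QX0 : 0 < 4 * (Q * X) by lra.
    have -> : 4 * (2 * l / (C * X)) = 8 * l / (C * X).
      by rewrite mulrA; congr (_ / _); ring.
    rewrite ler_pdivrMr // [leRHS]mulrAC ler_pdivlMr //.
    have : 64 * (Q * X) * l <= C * X * l.
      by rewrite ler_pM2r // mulrA ler_pM2r // ltW.
    have : 0 <= Q * X * l by rewrite mulr_ge0 ?(ltW lp) //; lra.
    lra.
  - rewrite -VmE.
    have V4X : 4 / V <= X by rewrite /X ler_pM2r ?invr_gt0 //; lra.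
    apply: (@le_trans _ _ (l / 1000 / 2000 * z)); last first.
      apply: ler_wpM2l zk.
      exact: divr_ge0 (divr_ge0 (ltW lp) (ler0n R 1000)) (ler0n R 2000).
    have -> : l / 1000 / 2000 * z = n%:R * (Q * X / 1000 / 2000).
      by rewrite /z; field; rewrite gt_eqF.
    rewrite QE mulrCA ler_wpM2l //; move: X2m; move: (2 ^+ m) => p; lra.
rewrite Pr_compl lerD2l lerN2; apply: le_trans tail _.
(* Half of the exponent X / 4 absorbs the factor 8, because X / 8 >= 4 and e^4 >= 16; the other half
   is the claimed bound. *)
have -> : - (1 / 8) * (1 / V) * Y = - (X / 8).
  by rewrite XE; field; rewrite gt_eqF.
apply: (@le_trans _ _ (8 * expR (- (X / 8) + - (X / 8)))).
  rewrite ler_pM2l // ler_expR; move: mX; move: (2 ^+ m) => p; lra.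
rewrite expRD mulrA ler_piMl ?expR_ge0 // expRN ler_pdivrMr ?expR_gt0 // mul1r.
by apply: (@le_trans _ _ 16); [lra|apply: expR_ge16; lra].
Qed.

Local Open Scope classical_set_scope.

Theorem theorem4p4 (R : realType) :
  exists C c : R, [/\ 1 < C, 0 < c &
    forall f : (forall n : nat, cube n -> bool),
      (\forall n \near \oo, MaxInf R (f n) < 1 / C) ->
      two_pow_neg_o (fun n => Var R (f n)) ->
      \forall n \near \oo,
        let tau := MaxInf R (f n) in
        let V := Var R (f n) in
        Pr R (fun x => V * ln (1 / tau) / (C * ln (ln (1 / tau)))
                       <= (bs (f n) x)%:R)
        >= 1 - expR (- c * (1 / V) * ln (ln (1 / tau)))].
Proof.
have [C C1 tail] := bs_tail R.
exists C, (1 / 8); split => // f fC [e [_ eV]].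
near=> n; apply: tail; first by near: n.
(* As a power of 2 the variance is positive, which [tail] asks for. *)
have -> : Var R (f n) = 2 `^ (- e n) by near: n.
by rewrite powR_gt0.
Unshelve. all: by end_near.
Qed.
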